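(* Let $\Gamma=(V,E)$ be a layered directed graph, $V=\cup_{i=0}^n V_i$, with $V_0=\{*\}$ where $*$ is the unique minimal vertex of $\Gamma$. Then $\{\hat e(\mathbf b)\mid\mathbf b\in\mathbf B(\Gamma)\}$ is a basis of the $F$-vector space $A(\Gamma)$ (the elements $\hat e(\mathbf b)$, indexed by $\mathbf b\in\mathbf B(\Gamma)$, are linearly independent and span $A(\Gamma)$).
   Context: $F$ is a field. A directed graph $\Gamma=(V,E)$ has a vertex set $V$, an edge set $E$, and functions $\mathbf t,\mathbf h:E\to V$ (tail and head). It is layered if $V=\cup_{i=0}^n V_i$, $E=\cup_{i=1}^n E_i$ (disjoint unions) with $\mathbf t:E_i\to V_i$ and $\mathbf h:E_i\to V_{i-1}$. That $*$ is the unique minimal vertex means that for every $v\in V$, $v\neq *$, there is $e\in E$ with $\mathbf t(e)=v$; for each such $v$ one edge $e_v$ with $\mathbf t(e_v)=v$ is fixed arbitrarily. Write $|v|=i$ if $v\in V_i$. A path from $v$ to $w$ is a sequence of edges $\pi=\{e_1,\dots,e_k\}$ with $\mathbf t(e_1)=v$, $\mathbf h(e_k)=w$, $\mathbf t(e_{i+1})=\mathbf h(e_i)$ for $1\le i<k$; put $\mathbf t(\pi)=v$, $\mathbf h(\pi)=w$, $l(\pi)=k$. Write $v>w$ if there is a path (with at least one edge) from $v$ to $w$. For $v\in V$ put $v^{(0)}=v$, $v^{(i+1)}=\mathbf h(e_{v^{(i)}})$ for $0\le i<|v|$, so $v^{(|v|)}=*$. $T(E)$ is the free associative unital $F$-algebra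 on $E$. For a path $\pi=\{e_1,\dots,e_k\}$ put $P_\pi(t)=(1-te_1)\cdots(1-te_k)\in T(E)[t]/(t^{n+1})$ and define $e(\pi,j)\in T(E)$ by $P_\pi(t)=\sum_{j=0}^{l(\pi)}(-1)^j e(\pi,j)t^j$. $R$ is the two-sided ideal of $T(E)$ generated by all $e(\pi_1,k)-e(\pi_2,k)$ with $\pi_1,\pi_2$ paths such that $\mathbf t(\pi_1)=\mathbf t(\pi_2)$, $\mathbf h(\pi_1)=\mathbf h(\pi_2)$, and $1\le k\le l(\pi_1)$. $A(\Gamma)=T(E)/R$, and $\tilde a$ denotes the image in $A(\Gamma)$ of $a\in T(E)$. For pairs $(v,k)$, $(u,l)$ with $u,v\in V$, $0\le k\le|v|$, $0\le l\le|u|$, write $(v,k)\models(u,l)$ if $v>u$ and $|u|=|v|-k$. $\mathbf B(\Gamma)$ is the set of all finite sequences $\mathbf b=((b_1,m_1),\dots,(b_s,m_s))$, $s\ge0$ (including the empty sequence), with $b_i\in V$, $1\le m_i\le|b_i|$ for all $i$, and $(b_i,m_i)\not\models(b_{i+1},m_{i+1})$ for $1\le i<s$. For $v\in V$, $1\le k\le|v|$, put $\hat e(v,k)=\tilde e_{v^{(0)}}\tilde e_{v^{(1)}}\cdots\tilde e_{v^{(k-1)}}\in A(\Gamma)$, where $\tilde e_{w}$ is the image of the chosen edge $e_{w}$. For $\mathbf b=((b_1,m_1),\dots,(b_s,m_s))\in\mathbf B(\Gamma)$ put $\hat e(\mathbf b)=\hat e(b_1,m_1)\cdots\hat e(b_s,m_s)$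 (equal to $1$ for the empty sequence). *)

(* Defs.v *)
From HB Require Import structures.
From mathcomp Require Import all_boot all_order all_algebra.
From mathcomp Require Import boolp.
From mathcomp Require Import finmap monalg.

Set Implicit Arguments.
Unset Strict Implicit.
Unset Printing Implicit Defensive.

Import GRing.Theory.

Local Open Scope ring_scope.

Section Basis.
Variables (K : fieldType) (M : lmodType K) (I : choiceType) (f : I -> M).

Definition linearly_independent : Prop :=
  forall (s : seq I) (c : I -> K), uniq s ->
    \sum_(i <- s) c i *: f i = 0 -> {in s, forall i, c i = 0}.

Definition spanning : Prop :=
  forall x : M, exists (s : seq I) (c : I -> K), x = \sum_(i <- s) c i *: f i.

Definition is_basis : Prop := linearly_independent /\ spanning.

End Basis.

Section TwoSidedIdeal.
Variable A : nzRingType.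

Inductive ideal_span (S : A -> Prop) : A -> Prop :=
| Ideal_gen x : S x -> ideal_span S x
| Ideal_0 : ideal_span S 0
| Ideal_D x y : ideal_span S x -> ideal_span S y -> ideal_span S (x + y)
| Ideal_Ml a x : ideal_span S x -> ideal_span S (a * x)
| Ideal_Mr a x : ideal_span S x -> ideal_span S (x * a).

(* Proper ideals only: the unit of an nzRingType differs from 0. *)
Record ideal2 := Ideal2 {
  ideal2_pred :> {pred A};
  ideal2_0 : 0 \in ideal2_pred;
  ideal2_D : {in ideal2_pred &, forall x y, x + y \in ideal2_pred};
  ideal2_Ml : forall a, {in ideal2_pred, forall x, a * x \in ideal2_pred};
  ideal2_Mr : forall a, {in ideal2_pred, forall x, x * a \in ideal2_pred};
  ideal2_1 : 1 \notin ideal2_pred }.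

Lemma ideal_span_proper (S : A -> Prop) : ~ ideal_span S 1 ->
  1 \notin [pred x : A | `[< ideal_span S x >]].
Proof. by move=> S1; rewrite inE; apply/asboolPn. Qed.

Definition span_ideal (S : A -> Prop) (S1 : ~ ideal_span S 1) : ideal2.
Proof.
refine (@Ideal2 [pred x : A | `[< ideal_span S x >]] _ _ _ _
          (ideal_span_proper S1)).
- by rewrite inE; apply/asboolP; apply: Ideal_0.
- move=> x y; rewrite !inE => /asboolP Sx /asboolP Sy.
  by apply/asboolP; apply: Ideal_D.
- move=> a x; rewrite !inE => /asboolP Sx.
  by apply/asboolP; apply: Ideal_Ml.
- move=> a x; rewrite !inE => /asboolP Sx.
  by apply/asboolP; apply: Ideal_Mr.
Defined.

Lemma mem_span_ideal (S : A -> Prop) (S1 : ~ ideal_span S 1) x :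
  reflect (ideal_span S x) (x \in span_ideal S1).
Proof. exact: asboolP. Qed.

Section Closed.
Variable I : ideal2.

Fact ideal2_zmod_closed : zmod_closed I.
Proof.
split=> [|x y Ix Iy]; first exact: ideal2_0.
by apply: ideal2_D => //; rewrite -mulN1r; apply: ideal2_Ml.
Qed.

HB.instance Definition _ :=
  GRing.isZmodClosed.Build A (ideal2_pred I) ideal2_zmod_closed.

End Closed.
End TwoSidedIdeal.

(* The library endows Quotient.quot with a ring structure only for ideals of
   commutative rings, hence the construction for two-sided ideals below. *)
Section AlgebraQuotient.
Import Quotient.
Local Open Scope quotient_scope.
Variables (K : fieldType) (A : algType K) (I : ideal2 A).

Definition alg_quot : Type := quot (ideal2_pred I).

HB.instance Definition _ := GRing.Zmodule.on alg_quot.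

Definition alg_proj (x : A) : alg_quot := \pi_(quot (ideal2_pred I)) x.

Lemma alg_projK (u : alg_quot) :
  alg_proj (repr (u : quot (ideal2_pred I))) = u.
Proof. exact: reprK. Qed.

Lemma eq_alg_proj x y : (alg_proj x == alg_proj y) = (x - y \in I).
Proof. by rewrite -equivE /alg_proj piE. Qed.

Fact alg_proj_zmod_morphism : zmod_morphism alg_proj.
Proof. by move=> x y; rewrite /alg_proj raddfB. Qed.

HB.instance Definition _ :=
  GRing.isZmodMorphism.Build A alg_quot alg_proj alg_proj_zmod_morphism.

Let rp (u : alg_quot) : A := repr (u : quot (ideal2_pred I)).

Let rpP x : rp (alg_proj x) - x \in I.
Proof. by rewrite -eq_alg_proj alg_projK. Qed.

Definition alg_quot_mul : alg_quot -> alg_quot -> alg_quot :=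
  lift_op2 (quot (ideal2_pred I)) *%R.
Definition alg_quot_scale (c : K) : alg_quot -> alg_quot :=
  lift_op1 (quot (ideal2_pred I)) ( *:%R c).

Let projM x y : alg_quot_mul (alg_proj x) (alg_proj y) = alg_proj (x * y).
Proof.
unlock alg_quot_mul; apply/eqP; rewrite eq_alg_proj.
rewrite -[_ - _](subrKA (rp (alg_proj x) * y)) -mulrBr -mulrBl.
by apply: ideal2_D; [apply: ideal2_Ml | apply: ideal2_Mr].
Qed.

Let projZ c x : alg_quot_scale c (alg_proj x) = alg_proj (c *: x).
Proof.
unlock alg_quot_scale; apply/eqP; rewrite eq_alg_proj -scalerBr -[_ - x]mul1r scalerAl.
exact: ideal2_Ml.
Qed.

Let alg_quot_ind (P : alg_quot -> Prop) :
  (forall x, P (alg_proj x)) -> forall u, P u.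
Proof. by move=> Pp u; rewrite -(alg_projK u). Qed.

Fact alg_quot_mulA : associative alg_quot_mul.
Proof.
elim/alg_quot_ind=> x; elim/alg_quot_ind=> y; elim/alg_quot_ind=> z.
by rewrite !projM mulrA.
Qed.

Fact alg_quot_1mul : left_id (alg_proj 1) alg_quot_mul.
Proof. by elim/alg_quot_ind=> x; rewrite projM mul1r. Qed.

Fact alg_quot_mul1 : right_id (alg_proj 1) alg_quot_mul.
Proof. by elim/alg_quot_ind=> x; rewrite projM mulr1. Qed.

Fact alg_quot_mulDl : left_distributive alg_quot_mul +%R.
Proof.
elim/alg_quot_ind=> x; elim/alg_quot_ind=> y; elim/alg_quot_ind=> z.
by rewrite -raddfD !projM -raddfD mulrDl.
Qed.

Fact alg_quot_mulDr : right_distributive alg_quot_mul +%R.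
Proof.
elim/alg_quot_ind=> x; elim/alg_quot_ind=> y; elim/alg_quot_ind=> z.
by rewrite -raddfD !projM -raddfD mulrDr.
Qed.

Fact alg_quot_1neq0 : alg_proj 1 != 0.
Proof. by rewrite -(raddf0 alg_proj) eq_alg_proj subr0 ideal2_1. Qed.

HB.instance Definition _ := GRing.Zmodule_isNzRing.Build alg_quot
  alg_quot_mulA alg_quot_1mul alg_quot_mul1 alg_quot_mulDl alg_quot_mulDr
  alg_quot_1neq0.

Fact alg_quot_scaleA a b u :
  alg_quot_scale a (alg_quot_scale b u) = alg_quot_scale (a * b) u.
Proof. by elim/alg_quot_ind: u => x; rewrite !projZ scalerA. Qed.

Fact alg_quot_scale1 : left_id 1 alg_quot_scale.
Proof. by elim/alg_quot_ind=> x; rewrite projZ scale1r. Qed.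

Fact alg_quot_scaleDr : right_distributive alg_quot_scale +%R.
Proof.
move=> a; elim/alg_quot_ind=> x; elim/alg_quot_ind=> y.
by rewrite -raddfD !projZ -raddfD scalerDr.
Qed.

Fact alg_quot_scaleDl u : {morph alg_quot_scale^~ u : a b / a + b}.
Proof.
by elim/alg_quot_ind: u => x a b; rewrite !projZ -raddfD scalerDl.
Qed.

HB.instance Definition _ := GRing.Zmodule_isLmodule.Build K alg_quot
  alg_quot_scaleA alg_quot_scale1 alg_quot_scaleDr alg_quot_scaleDl.

Fact alg_quot_scaleAl (a : K) (u v : alg_quot) : a *: (u * v) = (a *: u) * v.
Proof.
elim/alg_quot_ind: u => x; elim/alg_quot_ind: v => y.
rewrite /GRing.scale /GRing.mul /=.
by rewrite !(projM, projZ) scalerAl.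
Qed.

HB.instance Definition _ :=
  GRing.Lmodule_isLalgebra.Build K alg_quot alg_quot_scaleAl.

Fact alg_quot_scaleAr (a : K) (u v : alg_quot) : a *: (u * v) = u * (a *: v).
Proof.
elim/alg_quot_ind: u => x; elim/alg_quot_ind: v => y.
rewrite /GRing.scale /GRing.mul /=.
by rewrite !(projM, projZ) scalerAr.
Qed.

HB.instance Definition _ :=
  GRing.Lalgebra_isAlgebra.Build K alg_quot alg_quot_scaleAr.

Fact alg_proj_monoid_morphism : monoid_morphism alg_proj.
Proof. by split=> // x y; rewrite -projM. Qed.

HB.instance Definition _ :=
  GRing.isMonoidMorphism.Build A alg_quot alg_proj alg_proj_monoid_morphism.

Fact alg_proj_scalable : scalable alg_proj.
Proof. by move=> c x; rewrite -projZ. Qed.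

HB.instance Definition _ :=
  GRing.isScalable.Build K A alg_quot *:%R alg_proj alg_proj_scalable.

Lemma alg_proj_surj (u : alg_quot) : exists x, alg_proj x = u.
Proof. by exists (rp u); apply: alg_projK. Qed.

Lemma alg_proj_eq0 x : (alg_proj x == 0) = (x \in I).
Proof. by rewrite -(raddf0 alg_proj) eq_alg_proj subr0. Qed.

End AlgebraQuotient.

Section FreeAlgebra.
Variables (K : fieldType) (E : choiceType).

(* Finitely supported functions on the free monoid of words in E; multinomials
   provides an algType only over commutative monoids. *)
Definition free_alg : Type := {malg K[{fmonom E}]}.

HB.instance Definition _ := GRing.Lalgebra.on free_alg.

Fact free_alg_scaleAr (a : K) (x y : free_alg) : a *: (x * y) = x * (a *: y).
Proof.
have mulC (z : {malg K[{fmonom E}]}) : z * malgC a = a *: z.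
  rewrite malgM_def malgZ_def fgmulgU; apply: eq_bigr => m _.
  by rewrite mulm1 mulrC.
by rewrite -[a *: y]mulC mulrA [RHS]mulC.
Qed.

HB.instance Definition _ :=
  GRing.Lalgebra_isAlgebra.Build K free_alg free_alg_scaleAr.

Definition free_gen (e : E) : free_alg := mkmalgU (fmu e) 1.

End FreeAlgebra.

(* The layer of an edge is that of its tail, so the partition of the edges
   is determined by that of the vertices. *)
Record layered_graph (n : nat) := LayeredGraph {
  vertex : choiceType;
  edge : choiceType;
  tail : edge -> vertex;
  head : edge -> vertex;
  layer : vertex -> 'I_n.+1;
  layer_tail : forall e, layer (tail e) = (layer (head e)).+1 :> nat }.

Section Graph.
Variables (n : nat) (G : layered_graph n).
Local Notation V := (vertex G).
Local Notation E := (edge G).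
Implicit Types (v w u : V) (e : E) (p q : seq E).

Definition rank v : nat := layer v.

Definition is_path v w p : bool :=
  if p is e :: p' then
    [&& tail e == v, path (fun e1 e2 => tail e2 == head e1) e p'
      & head (last e p') == w]
  else false.

Definition gtv v w : Prop := exists p, is_path v w p.

Definition minimal_vertex (star : V) : Prop :=
  forall v, v != star -> exists e, tail e = v.

Definition entails (a b : V * nat) : Prop :=
  gtv a.1 b.1 /\ rank b.1 = (rank a.1 - a.2)%N.

Definition is_basis_index (s : seq (V * nat)) : bool :=
  all (fun a => 1 <= a.2 <= rank a.1)%N s
  && sorted (fun a b => `[< ~ entails a b >]) s.

Definition basis_index : Type := {s : seq (V * nat) | is_basis_index s}.

HB.instance Definition _ := Choice.on basis_index.

(* P_p(t) and e(p, j) for the images x e of the edges in a ring R.  A path has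
   at most n edges, so that truncating modulo t^(n+1) would not affect any
   coefficient. *)
Definition path_poly (R : nzRingType) (x : E -> R) p : {poly R} :=
  \prod_(e <- p) (1 - (x e)%:P * 'X).

Definition path_elem (R : nzRingType) (x : E -> R) p (j : nat) : R :=
  (-1) ^+ j * (path_poly x p)`_j.

Lemma rmorph_path_elem (R S : nzRingType) (f : {rmorphism R -> S})
  (x : E -> R) p j : f (path_elem x p j) = path_elem (f \o x) p j.
Proof.
rewrite /path_elem /path_poly rmorphM rmorphXn rmorphN1 -coef_map rmorph_prod /=.
congr (_ * nth _ (polyseq _) _); apply: eq_bigr => e _.
by rewrite rmorphB rmorph1 rmorphM /= map_polyC map_polyX.
Qed.

Section Algebra.
Variable K : fieldType.
Local Notation T := (free_alg K E).

Definition relator (z : T) : Prop :=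
  exists v w p q k, [/\ is_path v w p, is_path v w q, (1 <= k <= size p)%N
    & z = path_elem (@free_gen K E) p k - path_elem (@free_gen K E) q k].

Let aug : {rmorphism T -> K} :=
  @mcoeff {fmonom E} K (@mone {fmonom E}) : {rmorphism {malg K[{fmonom E}]} -> K}.

Fact path_elem_coef1 p k :
  (0 < k)%N -> aug (path_elem (@free_gen K E) p k) = 0.
Proof.
move=> k_gt0; rewrite rmorph_path_elem /path_elem /path_poly big1 => [|e _].
  by rewrite coef1 gtn_eqF // mulr0.
have -> : (aug \o @free_gen K E) e = 0.
  by rewrite /= [LHS]mcoeffU1 -fdeg_eq0 fdegU.
by rewrite polyC0 mul0r subr0.
Qed.

Fact relator_proper : ~ ideal_span relator 1.
Proof.
suff aug0 x : ideal_span relator x -> aug x = 0.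
  by move/aug0/eqP; rewrite rmorph1 oner_eq0.
elim=> {x} [x [v [w [p [q [k [_ _ /andP[k_gt0 _] ->]]]]]]||x y _ IHx _ IHy
  |a x _ IHx|a x _ IHx].
- rewrite rmorphB -[RHS]subr0; congr (_ - _); exact: path_elem_coef1.
- exact: rmorph0.
- by rewrite rmorphD /= IHx IHy addr0.
- by rewrite rmorphM /= IHx mulr0.
- by rewrite rmorphM /= IHx mul0r.
Qed.

Definition relation_ideal : ideal2 T := span_ideal relator_proper.

Definition graph_alg : Type := alg_quot relation_ideal.

HB.instance Definition _ := GRing.Algebra.on graph_alg.

Definition egen e : graph_alg := alg_proj relation_ideal (free_gen K e).

Variables (star : V) (chosen : {v : V | v != star} -> E).

Definition chosen_edge v : option E := omap chosen (insub v).

(* The default values below are only reached at star. *)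
Definition next_vertex v : V := oapp (@head n G) v (chosen_edge v).

Definition ehat v (k : nat) : graph_alg :=
  \prod_(i < k) oapp egen 1 (chosen_edge (iter i next_vertex v)).

Definition ehat_seq (s : seq (V * nat)) : graph_alg :=
  \prod_(a <- s) ehat a.1 a.2.

End Algebra.
End Graph.

(* Main.v *)
Require Import Defs.
From HB Require Import structures.
From mathcomp Require Import all_boot all_order all_algebra.
From mathcomp Require Import boolp.
From mathcomp Require Import finmap monalg zify.

(** Weigh an edge by the rank of its tail and filter the algebra by the total
    weight of monomials in the edges.  Ranks drop along a path, so the product
    of the first k edges of a path p dominates the coefficient e(p, k)
    ([path_elem_lead]); and the relations say that e(p, k) depends only on the
    two ends of p.  Hence, modulo smaller weight, the product of the first k
    edges of any path from v to star is ehat(v, k) ([path_lead_ehat]).  In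
    particular an edge with tail v is congruent to ehat(v, 1), and
    ehat(v, k) ehat(u, l) to ehat(v, k + l) whenever (v, k) |= (u, l), as one
    sees on a path from v through u to star ([merge_lead]).  Rewriting with
    these congruences, by induction on the weight and then on the number of
    factors, shows that the words of B(Gamma) span ([filt_span]).  The argument
    uses nothing but the leading terms, so it applies equally to the family
    e(v, k) of coefficients of the chosen path from v to star.

    For independence, let M be the vector space with basis B(Gamma).  It
    suffices to let the algebra act on M so that e(v, k) sends a word b to
    (v, k) b, up to sign, whenever (v, k) b is in B(Gamma) ([graph_alg_rep]):
    acting on the empty word then shows that the products of the e(v, k) are
    independent, and, both families having the same leading terms, so are the
    products of the ehat(v, k) ([ehat_independent]).

    An action is the same as a family of operator polynomials P_v(t), equal to
    1 at t = 0 and of degree at most r = |v|, such that P_v = (1 - X_e t) P_w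
    for every edge e from v to w.  Reversing the coefficients, t^r P_v(1/t) is
    a monic polynomial of degree r, which encodes a linear recurrence of order
    r for sequences in M; its solutions form a shift-stable space of sequences
    that are freely determined by their first r entries, and the condition on
    edges says that the solutions for w are among those for v.  So the problem
    is to find such spaces of sequences.  They are realized inside M: an
    endomorphism T of M plays the part of the shift, and the solutions for v are
    the sequences of coordinates ([crd]) of the elements x of N_v, the span of
    the nonempty words with first vertex v or below v.  What one
    wants is that a word (v, r - c) b has b as its c-th coordinate, itself as
    its r-th coordinate, and no other nonzero coordinate among the first r
    ([coherent]).  Such a T is built rank by rank ([coherent_step]): its value
    on a word headed by v is forced by the shifted coordinates, because the
    first r coordinates identify N_v with M^r.  That identification
    ([gam_surj], [crd_inj]) is a triangular elimination: at place c < r, a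
    word whose head has rank c contributes itself, a word whose head has a
    smaller rank contributes no word headed by a vertex of rank c ([crd_high]),
    and a word headed by v contributes only words to which (v, r - c) may be
    prepended. *)

Set Implicit Arguments.
Unset Strict Implicit.
Unset Printing Implicit Defensive.

Import Defs GRing.Theory.
Local Open Scope ring_scope.

(** * Vector spaces with a basis and their endomorphism algebras *)

Section FreeModule.
Variables (K : fieldType) (I : choiceType).

(** A separate name, with the locked operations below, keeps unification from
    unfolding finitely supported functions. *)
Definition fmod : Type := {malg K[I]}.
HB.instance Definition _ := GRing.Lmodule.on fmod.

End FreeModule.

HB.lock Definition vec (K : fieldType) (I : choiceType) (i : I) : fmod K I :=
  << i >>.

HB.lock Definition cf (K : fieldType) (I : choiceType) (i : I) (x : fmod K I)
  : K := x@_i.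

HB.lock Definition supp (K : fieldType) (I : choiceType) (x : fmod K I)
  : seq I := msupp x.

HB.lock Definition lext (K : fieldType) (I : choiceType) (V : lmodType K)
  (f : I -> V) (x : fmod K I) : V := \sum_(i <- supp x) cf i x *: f i.

Section FreeModuleTheory.
Variables (K : fieldType) (I : choiceType).
Local Notation M := (fmod K I).
Local Notation vec := (@vec K I).
Implicit Types (x y : M) (i : I).

Lemma cf0 i : cf i (0 : M) = 0.
Proof. by rewrite cf.unlock; apply: mcoeff0. Qed.

Lemma cfD i x y : cf i (x + y) = cf i x + cf i y.
Proof. by rewrite cf.unlock; apply: mcoeffD. Qed.

Lemma cfZ i a x : cf i (a *: x) = a * cf i x.
Proof. by rewrite cf.unlock; apply: mcoeffZ. Qed.

Lemma cfN i x : cf i (- x) = - cf i x.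
Proof. by rewrite -scaleN1r cfZ mulN1r. Qed.

Lemma cfB i x y : cf i (x - y) = cf i x - cf i y.
Proof. by rewrite cfD cfN. Qed.

Lemma cfMn i x k : cf i (x *+ k) = cf i x *+ k.
Proof. by elim: k => [|k IHk]; rewrite ?mulr0n ?cf0 // !mulrS cfD IHk. Qed.

Lemma cf_sum i (J : Type) (s : seq J) (p : pred J) (F : J -> M) :
  cf i (\sum_(j <- s | p j) F j) = \sum_(j <- s | p j) cf i (F j).
Proof. by elim/big_rec2: _ => [|j a x _ <-]; rewrite ?cf0 ?cfD. Qed.

Lemma cf_vec i k : cf i (vec k) = (k == i)%:R.
Proof. by rewrite cf.unlock vec.unlock [LHS]mcoeffU. Qed.

Lemma fmodP x y : (forall i, cf i x = cf i y) -> x = y.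
Proof. by move=> xy; apply/malgP => i; have := xy i; rewrite cf.unlock. Qed.

Lemma supp_uniq x : uniq (supp x).
Proof. by rewrite supp.unlock; apply: fset_uniq. Qed.

Lemma mem_supp x i : (i \in supp x) = (cf i x != 0).
Proof. by rewrite supp.unlock cf.unlock mcoeff_neq0. Qed.

Lemma fmod_expand x : x = \sum_(i <- supp x) cf i x *: vec i.
Proof.
apply: fmodP => k; rewrite cf_sum.
have [kx|] := boolP (k \in supp x).
  rewrite (bigD1_seq k) ?supp_uniq //= big1 ?addr0 => [|i ik].
    by rewrite cfZ cf_vec eqxx mulr1.
  by rewrite cfZ cf_vec (negPf ik) mulr0.
rewrite mem_supp negbK => /eqP k0; rewrite k0 big1 // => i _.
by rewrite cfZ cf_vec; case: eqP => [->|_]; rewrite ?k0 ?mul0r ?mulr0.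
Qed.

Section LinearExtension.
Variable V : lmodType K.
Implicit Types f : I -> V.

Lemma lextE f (s : seq I) x : uniq s -> {subset supp x <= s} ->
  lext f x = \sum_(i <- s) cf i x *: f i.
Proof.
move=> us xs; rewrite lext.unlock [RHS](bigID [pred k | k \in supp x]) /=.
rewrite [X in _ + X]big1 ?addr0 => [|k]; last first.
  by rewrite mem_supp negbK => /eqP->; rewrite scale0r.
rewrite -[RHS]big_filter; apply: perm_big; apply: uniq_perm.
- exact: supp_uniq.
- exact: filter_uniq.
- by move=> k; rewrite mem_filter; case: (boolP (k \in supp x)) => // /xs->.
Qed.

Fact lext_is_linear f : linear (lext f).
Proof.
move=> a x y; pose s := undup (supp (a *: x + y) ++ supp x ++ supp y).
have us : uniq s by apply: undup_uniq.
have sub z : {subset supp z <= supp (a *: x + y) ++ supp x ++ supp y} ->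
    {subset supp z <= s}.
  by move=> sz k kz; rewrite mem_undup sz.
rewrite !(lextE f us) => [||k kx|k kx]; last 3 first.
- by apply: sub => k kx; rewrite !mem_cat kx ?orbT.
- by rewrite mem_undup !mem_cat kx ?orbT.
- by rewrite mem_undup !mem_cat kx ?orbT.
rewrite scaler_sumr -big_split /=; apply: eq_bigr => k _.
by rewrite cfD cfZ scalerDl scalerA.
Qed.

HB.instance Definition _ f :=
  GRing.isLinear.Build K M V *:%R (lext f) (lext_is_linear f).

Lemma lext0 f : lext f 0 = 0. Proof. exact: linear0. Qed.
Lemma lextD f x y : lext f (x + y) = lext f x + lext f y.
Proof. exact: linearD. Qed.
Lemma lextZ f a x : lext f (a *: x) = a *: lext f x.
Proof. exact: linearZ. Qed.

Lemma lext_vec f i : lext f (vec i) = f i.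
Proof.
rewrite (@lextE f [:: i]) // => [|k]; last first.
  by rewrite mem_supp cf_vec inE; case: (eqVneq i k); rewrite ?eqxx.
by rewrite big_seq1 cf_vec eqxx scale1r.
Qed.

End LinearExtension.

Implicit Types (P Q : I -> Prop).

Definition supp_in P x : Prop := forall i, cf i x != 0 -> P i.

Lemma supp_in0 P : supp_in P 0.
Proof. by move=> i; rewrite cf0 eqxx. Qed.

Lemma supp_inD P x y : supp_in P x -> supp_in P y -> supp_in P (x + y).
Proof.
move=> Px Py i; rewrite cfD => xy.
have [x0|/Px//] := eqVneq (cf i x) 0.
by apply: Py; move: xy; rewrite x0 add0r.
Qed.

Lemma supp_inZ P a x : supp_in P x -> supp_in P (a *: x).
Proof. by move=> Px i; rewrite cfZ mulf_eq0 negb_or => /andP[_ /Px]. Qed.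

Lemma supp_inB P x y : supp_in P x -> supp_in P y -> supp_in P (x - y).
Proof.
by move=> Px Py; apply: supp_inD => //; rewrite -scaleN1r; apply: supp_inZ.
Qed.

Lemma supp_in_vec P i : P i -> supp_in P (vec i).
Proof.
by move=> Pi k; rewrite cf_vec; case: (eqVneq i k) => [<-|_]; rewrite ?eqxx.
Qed.

Lemma supp_in_sum P (J : Type) (s : seq J) (p : pred J) F :
  (forall j, p j -> supp_in P (F j)) -> supp_in P (\sum_(j <- s | p j) F j).
Proof.
move=> PF; elim/big_rec: _ => [|j x pj Px]; first exact: supp_in0.
by apply: supp_inD => //; apply: PF.
Qed.

Lemma supp_in_sub P Q x : (forall i, P i -> Q i) -> supp_in P x -> supp_in Q x.
Proof. by move=> PQ Px i /Px/PQ. Qed.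

Lemma supp_in_T x : supp_in (fun=> True) x. Proof. by []. Qed.
Arguments supp_in_T : clear implicits.

Lemma supp_in_cf0 P x i : supp_in P x -> ~ P i -> cf i x = 0.
Proof. by move=> Px nPi; apply/eqP/negP => /negP/Px. Qed.

(** Most supports are bounded, and most linear identities checked, through this
    principle: it reduces both to basis vectors. *)
Lemma supp_in_ind P (Q : M -> Prop) : Q 0 ->
  (forall x y, Q x -> Q y -> Q (x + y)) ->
  (forall a x, Q x -> Q (a *: x)) ->
  (forall i, P i -> Q (vec i)) ->
  forall x, supp_in P x -> Q x.
Proof.
move=> Q0 QD QZ QU x Px; rewrite [x]fmod_expand big_seq.
elim/big_rec: _ => // i y ix Qy; apply: QD => //; apply: QZ; apply: QU.
by apply: Px; rewrite -mem_supp.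
Qed.

Lemma lin_eq_on (V : lmodType K) (f h : {linear M -> V}) P :
  (forall i, P i -> f (vec i) = h (vec i)) ->
  forall x, supp_in P x -> f x = h x.
Proof.
move=> fh; apply: supp_in_ind => //; first by rewrite !linear0.
- by move=> x y fx fy; rewrite !linearD fx fy.
- by move=> a x fx; rewrite !linearZ fx.
Qed.

Definition proj_on (p : pred I) x : M :=
  lext (fun i => if p i then vec i else 0) x.

Lemma cf_proj_on p x i : cf i (proj_on p x) = if p i then cf i x else 0.
Proof.
rewrite /proj_on; move: x (supp_in_T x); apply: supp_in_ind => //.
- by rewrite lext0 cf0 if_same.
- by move=> x y fx fy; rewrite lextD !cfD fx fy; case: ifP; rewrite ?addr0.
- by move=> a x fx; rewrite lextZ !cfZ fx; case: ifP; rewrite ?mulr0.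
- move=> j _; rewrite lext_vec cf_vec; case: (eqVneq j i) => [->|ji].
    by case: ifP; rewrite ?cf0 // cf_vec eqxx.
  by rewrite if_same; case: (p j); rewrite ?cf_vec ?(negPf ji) ?cf0.
Qed.

End FreeModuleTheory.

Arguments supp_in_T {K I} x _ _ : rename.

Lemma supp_in_lext (K : fieldType) (I J : choiceType) (P : I -> Prop)
  (Q : J -> Prop) (f : J -> fmod K I) x :
  (forall j, Q j -> supp_in P (f j)) -> supp_in Q x -> supp_in P (lext f x).
Proof.
move=> Pf; move: x; apply: supp_in_ind.
- by rewrite lext0; apply: supp_in0.
- by move=> x y; rewrite lextD; apply: supp_inD.
- by move=> a x; rewrite lextZ; apply: supp_inZ.
- by move=> j Qj; rewrite lext_vec; apply: Pf.
Qed.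

(** An endomorphism is given by the images of the basis vectors, so that
    composition is a product of column-finite matrices.  The point i0 only
    witnesses that the space, hence the ring, is nontrivial. *)
Definition endo (K : fieldType) (I : choiceType) (i0 : I) : Type :=
  I -> fmod K I.

HB.lock Definition eapp (K : fieldType) (I : choiceType) (i0 : I)
  (f : endo K i0) (x : fmod K I) : fmod K I := lext f x.

Section Endo.
Variables (K : fieldType) (I : choiceType) (i0 : I).
Local Notation M := (fmod K I).
Local Notation endo := (endo K i0).

HB.instance Definition _ := gen_eqMixin endo.
HB.instance Definition _ := gen_choiceMixin endo.

Implicit Types f g h : endo.

Lemma eapp_lext f x : eapp f x = lext f x. Proof. by rewrite eapp.unlock. Qed.

Fact eapp_is_linear f : linear (eapp f).
Proof. by move=> a x y; rewrite !eapp_lext linearP. Qed.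
HB.instance Definition _ f :=
  GRing.isLinear.Build K M M *:%R (eapp f) (eapp_is_linear f).

Lemma eappE f x : eapp f x = \sum_(i <- supp x) cf i x *: f i.
Proof. by rewrite eapp.unlock lext.unlock. Qed.

Lemma eappr0 f : eapp f 0 = 0. Proof. exact: linear0. Qed.
Lemma eapprD f x y : eapp f (x + y) = eapp f x + eapp f y.
Proof. exact: linearD. Qed.
Lemma eapprB f x y : eapp f (x - y) = eapp f x - eapp f y.
Proof. exact: linearB. Qed.
Lemma eapprZ f a x : eapp f (a *: x) = a *: eapp f x.
Proof. exact: linearZ. Qed.
Lemma eapp_vec f i : eapp f (vec K i) = f i.
Proof. by rewrite eapp_lext lext_vec. Qed.

Lemma supp_in_eapp (P Q : I -> Prop) f x :
  (forall i, Q i -> supp_in P (f i)) -> supp_in Q x -> supp_in P (eapp f x).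
Proof. by rewrite eapp_lext; apply: supp_in_lext. Qed.

Lemma eapp_eq_on (P : I -> Prop) f g x : (forall i, P i -> f i = g i) ->
  supp_in P x -> eapp f x = eapp g x.
Proof.
by move=> fg; apply: lin_eq_on => i Pi; rewrite /= !eapp_vec fg.
Qed.

(** Reads one coefficient of f x off one coefficient of x; this is how the
    triangular shape of a system of equations is used below. *)
Lemma cf_eapp_on (P : I -> Prop) f j k x :
  (forall i, P i -> cf j (f i) = (i == k)%:R) ->
  supp_in P x -> cf j (eapp f x) = cf k x.
Proof.
move=> fjk; move: x; apply: supp_in_ind => [|x y IHx IHy|a x IHx|i Pi].
- by rewrite eappr0 !cf0.
- by rewrite eapprD !cfD IHx IHy.
- by rewrite eapprZ !cfZ IHx.
- by rewrite eapp_vec fjk // cf_vec.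
Qed.

Lemma endoP f g : (forall i, f i = g i) -> f = g. Proof. exact: funext. Qed.

Let eadd f g : endo := fun i => f i + g i.
Let eopp f : endo := fun i => - f i.
Let ezero : endo := fun=> 0.
Let eone : endo := fun i => vec K i.
Let emul f g : endo := fun i => eapp f (g i).
Let escale (a : K) f : endo := fun i => a *: f i.

Let eaddA : associative eadd.
Proof. by move=> f g h; apply: endoP => i; apply: addrA. Qed.
Let eaddC : commutative eadd.
Proof. by move=> f g; apply: endoP => i; apply: addrC. Qed.
Let eadd0 : left_id ezero eadd.
Proof. by move=> f; apply: endoP => i; apply: add0r. Qed.
Let eaddN : left_inverse ezero eopp eadd.
Proof. by move=> f; apply: endoP => i; apply: addNr. Qed.

HB.instance Definition _ :=
  GRing.isZmodule.Build endo eaddA eaddC eadd0 eaddN.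

Let eappD f g x : eapp (f + g) x = eapp f x + eapp g x.
Proof.
by rewrite !eappE -big_split; apply: eq_bigr => i _; apply: scalerDr.
Qed.

Let eappZ a f x : eapp (escale a f) x = a *: eapp f x.
Proof.
by rewrite !eappE scaler_sumr; apply: eq_bigr => i _; rewrite !scalerA mulrC.
Qed.

Let eappM f g x : eapp (emul f g) x = eapp f (eapp g x).
Proof.
rewrite [eapp g x]eappE [LHS]eappE linear_sum.
by apply: eq_bigr => i _; rewrite linearZ.
Qed.

Let emulA : associative emul.
Proof. by move=> f g h; apply: endoP => i; rewrite /emul -eappM. Qed.
Let emul1 : left_id eone emul.
Proof.
by move=> f; apply: endoP => i; rewrite /emul eappE [RHS]fmod_expand.
Qed.
Let emulr1 : right_id eone emul.
Proof. by move=> f; apply: endoP => i; rewrite /emul eapp_vec. Qed.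
Let emulDl : left_distributive emul +%R.
Proof. by move=> f g h; apply: endoP => i; rewrite /emul eappD. Qed.
Let emulDr : right_distributive emul +%R.
Proof. by move=> f g h; apply: endoP => i; apply: linearD. Qed.
Let eone_neq0 : eone != 0.
Proof.
apply/eqP => /(congr1 (fun f : endo => cf i0 (f i0))).
by rewrite /eone cf_vec eqxx cf0 => /eqP; rewrite oner_eq0.
Qed.

HB.instance Definition _ := GRing.Zmodule_isNzRing.Build endo
  emulA emul1 emulr1 emulDl emulDr eone_neq0.

Let escaleA a b f : escale a (escale b f) = escale (a * b) f.
Proof. by apply: endoP => i; apply: scalerA. Qed.
Let escale1 : left_id 1 escale.
Proof. by move=> f; apply: endoP => i; apply: scale1r. Qed.
Let escaleDr : right_distributive escale +%R.
Proof. by move=> a f g; apply: endoP => i; apply: scalerDr. Qed.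
Let escaleDl f : {morph escale^~ f : a b / a + b}.
Proof. by move=> a b; apply: endoP => i; apply: scalerDl. Qed.

HB.instance Definition _ := GRing.Zmodule_isLmodule.Build K endo
  escaleA escale1 escaleDr escaleDl.

Let escaleAl (a : K) (f g : endo) : a *: (f * g) = (a *: f) * g.
Proof. by apply: endoP => i; rewrite [RHS]eappZ. Qed.
HB.instance Definition _ := GRing.Lmodule_isLalgebra.Build K endo escaleAl.
Let escaleAr (a : K) (f g : endo) : a *: (f * g) = f * (a *: g).
Proof. by apply: endoP => i; symmetry; apply: linearZ. Qed.
HB.instance Definition _ := GRing.Lalgebra_isAlgebra.Build K endo escaleAr.

Lemma endoDE f g i : (f + g) i = f i + g i. Proof. by []. Qed.
Lemma endoME f g i : (f * g) i = eapp f (g i). Proof. by []. Qed.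

Lemma eapp0 x : eapp (0 : endo) x = 0.
Proof. by rewrite eappE; apply: big1 => i _; apply: scaler0. Qed.
Lemma eapp1 x : eapp (1 : endo) x = x.
Proof. by rewrite eappE [RHS]fmod_expand. Qed.
Lemma eapp_add f g x : eapp (f + g) x = eapp f x + eapp g x.
Proof. exact: eappD. Qed.
Lemma eapp_scale a f x : eapp (a *: f) x = a *: eapp f x.
Proof. exact: eappZ. Qed.
Lemma eapp_mul f g x : eapp (f * g) x = eapp f (eapp g x).
Proof. exact: eappM. Qed.

End Endo.

(** * Universal properties of free algebras and quotients *)

Section FreeAlgebraLift.
Variables (K : fieldType) (E : choiceType) (S : algType K) (x : E -> S).

Lemma free_alg_lift : exists phi : {lrmorphism free_alg K E -> S},
  forall e, phi (free_gen K e) = x e.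
Proof.
pose h (w : {fmonom E}) : S := \prod_(e <- (w : seq E)) x e.
pose phi (g : free_alg K E) : S := lext h (g : fmod K _).
have phiL : linear phi by move=> a y z; rewrite /phi linearP.
have phiU w : phi (vec K w) = h w by apply: lext_vec.
have phi0 : phi 0 = 0 by apply: linear0.
have phiD : {morph phi : y z / y + z} by move=> y z; apply: linearD.
have phiZ a : {morph phi : y / a *: y} by move=> y; apply: linearZ.
have phiM : monoid_morphism phi.
  split=> [|y z].
    by have := phiU mone; rewrite vec.unlock /h fm1 big_nil.
  move: y (supp_in_T y); apply: supp_in_ind => [|y y'|a y|w _].
  - by rewrite mul0r phi0 mul0r.
  - by rewrite mulrDl !phiD mulrDl => -> ->.
  - by rewrite -scalerAl !phiZ -scalerAl => ->.
  move: z (supp_in_T z); apply: supp_in_ind => [|y y'|a y|w' _].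
  - by rewrite mulr0 phi0 mulr0.
  - by rewrite mulrDr !phiD mulrDr => -> ->.
  - by rewrite -scalerAr !phiZ -scalerAr => ->.
  have hM : phi (vec K (mmul w w')) = h w * h w'.
    by rewrite phiU /h fmM big_cat.
  rewrite !phiU -hM; congr (phi _).
  by rewrite vec.unlock malgM_def fgmulUU mulr1.
pose L := GRing.isLinear.Build K (free_alg K E) S *:%R phi phiL.
pose R := GRing.isMonoidMorphism.Build (free_alg K E) S phi phiM.
pose F : {lrmorphism free_alg K E -> S} := HB.pack phi L R.
by exists F => e; have := phiU (fmu e); rewrite vec.unlock /h fmU big_seq1.
Qed.
End FreeAlgebraLift.

Section QuotientLift.
Variables (K : fieldType) (A S : algType K) (X : A -> Prop).
Variables (X1 : ~ ideal_span X 1) (phi : {lrmorphism A -> S}).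
Hypothesis phiX : forall x, X x -> phi x = 0.
Local Notation I := (span_ideal X1).

Lemma alg_quot_lift : exists Phi : {lrmorphism alg_quot I -> S},
  forall x, Phi (alg_proj I x) = phi x.
Proof.
have phi0 x : ideal_span X x -> phi x = 0.
  elim=> {x} [x /phiX //||x y _ Ix _ Iy|a x _ Ix|a x _ Ix].
  - exact: raddf0.
  - by rewrite rmorphD /= Ix Iy addr0.
  - by rewrite rmorphM /= Ix mulr0.
  - by rewrite rmorphM /= Ix mul0r.
pose Phi (u : alg_quot I) : S := phi (projT1 (cid (alg_proj_surj u))).
have PhiE x : Phi (alg_proj I x) = phi x.
  rewrite /Phi; case: cid => y /= /eqP; rewrite eq_alg_proj => /mem_span_ideal.
  by move/phi0/eqP; rewrite rmorphB subr_eq0 => /eqP.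
have PhiL : linear Phi.
  move=> a u v; have [[x <-] [y <-]] := (alg_proj_surj u, alg_proj_surj v).
  by rewrite -linearP !PhiE linearP.
have PhiM : monoid_morphism Phi.
  split=> [|u v]; first by rewrite -(rmorph1 (alg_proj I)) PhiE rmorph1.
  have [[x <-] [y <-]] := (alg_proj_surj u, alg_proj_surj v).
  by rewrite -rmorphM !PhiE rmorphM.
pose L := GRing.isLinear.Build K (alg_quot I) S *:%R Phi PhiL.
pose R := GRing.isMonoidMorphism.Build (alg_quot I) S Phi PhiM.
pose F : {lrmorphism alg_quot I -> S} := HB.pack Phi L R.
by exists F.
Qed.
End QuotientLift.

(** * Paths and words *)

Section Walks.
Variables (n : nat) (G : layered_graph n).
Local Notation V := (vertex G).
Local Notation E := (edge G).
Implicit Types (v w u : V) (e : E) (p q : seq E).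

(** Unlike [is_path], this allows the empty path and so can be cut anywhere. *)
Fixpoint walk (v w : V) (p : seq E) : bool :=
  if p is e :: p' then (tail e == v) && walk (head e) w p' else v == w.

Lemma is_pathE v w p : is_path v w p = (p != [::]) && walk v w p.
Proof.
case: p => [|e p] //=; congr (_ && _).
by elim: p e => [|f p IHp] e //=; rewrite -IHp andbA.
Qed.

Lemma cat_walk u v w p q : walk v u p -> walk u w q -> walk v w (p ++ q).
Proof.
by elim: p v => [|e p IHp] v /= => [/eqP->//|/andP[-> pu] /(IHp _ pu)].
Qed.

Lemma rank_tail e : rank (tail e) = (rank (head e : V)).+1.
Proof. exact: layer_tail. Qed.

Lemma walk_rank v w p : walk v w p -> rank v = (rank w + size p)%N.
Proof.
elim: p v => [|e p IHp] v /=; first by move/eqP->; rewrite addn0.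
by case/andP=> /eqP<- /IHp; rewrite rank_tail => ->; rewrite addnS.
Qed.

Lemma gtv_walk v w : gtv v w <-> exists2 p, p != [::] & walk v w p.
Proof.
split=> [[p]|[p p0 pw]]; last by exists p; rewrite is_pathE p0.
by rewrite is_pathE => /andP[]; exists p.
Qed.

Lemma gtv_rank v w : gtv v w -> (rank w < rank v)%N.
Proof.
case/gtv_walk=> -[//|e p] _ /walk_rank->.
by rewrite -addn1 leq_add2l.
Qed.

Lemma gtv_trans u v w : gtv v u -> gtv u w -> gtv v w.
Proof.
case/gtv_walk=> p p0 vu /gtv_walk[q q0 uw]; apply/gtv_walk; exists (p ++ q).
  by case: (p) p0.
exact: cat_walk uw.
Qed.

Lemma gtv_edge e : gtv (tail e) (head e : V).
Proof. by apply/gtv_walk; exists [:: e] => //=; rewrite !eqxx. Qed.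

End Walks.

Section Words.
Variables (n : nat) (G : layered_graph n).
Local Notation V := (vertex G).
Local Notation B := (basis_index G).
Implicit Types (v u w : V) (b : B).

Definition nilB : B := exist _ [::] isT.

(** The word (v, |v| - c) b.  The letter is indexed by its complement c, the
    rank at which the next letter would be entailed and also the place at which
    b will stand in the sequence attached to the word. *)
Definition consB v (c : nat) b : B :=
  insubd nilB ((v, (rank v - c)%N) :: val b).

(** The condition for (v, |v| - c) b to be again a word of the basis. *)
Definition fits v (c : nat) b : Prop :=
  if val b is a :: _ then ~ (gtv v a.1 /\ rank a.1 = c) else True.

Definition headed (P : V -> Prop) b : Prop :=
  if val b is a :: _ then P a.1 else False.

Lemma val_consB v c b : (c < rank v)%N -> fits v c b ->
  val (consB v c b) = (v, (rank v - c)%N) :: val b.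
Proof.
rewrite /fits => cv okb; rewrite val_insubd; case: ifP => // /negP[].
move: okb (valP b); rewrite /is_basis_index.
case: (val b) => [|a s] okb /andP[/= alls sorts];
  rewrite subn_gt0 cv leq_subr //=.
rewrite alls sorts andbT; apply/asboolP => -[va].
rewrite /= subKn; last exact: ltnW.
by move=> ac; apply: okb.
Qed.

Lemma consB_inj v c b v' c' b' :
  (c < rank v)%N -> fits v c b -> (c' < rank v')%N -> fits v' c' b' ->
  consB v c b = consB v' c' b' -> [/\ v = v', c = c' & b = b'].
Proof.
move=> cv okb cv' okb' /(congr1 val); rewrite !val_consB // => -[vv' cc' bb'].
split=> //; last exact: val_inj.
by move: cc' cv cv'; rewrite vv'; lia.
Qed.

Lemma consB_surj b :
  b = nilB \/
  exists v c b', [/\ (c < rank v)%N, fits v c b' & b = consB v c b'].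
Proof.
case eb: (val b) => [|[v k] s]; [left; exact: val_inj|right].
have := valP b; rewrite eb => /andP[/= /andP[kv alls] sorts].
have Bs : is_basis_index s by rewrite /is_basis_index alls (path_sorted sorts).
pose b' : B := exist _ s Bs.
have cv : (rank v - k < rank v)%N by lia.
have okb : fits v (rank v - k) b'.
  rewrite /fits /=; case: (s) sorts => //= a s' /andP[/asboolP nva _] [va ra].
  by apply: nva.
exists v, (rank v - k)%N, b'; split=> //.
by apply: val_inj; rewrite val_consB // eb subKn //; lia.
Qed.

Lemma headed_consB P v c b : (c < rank v)%N -> fits v c b ->
  headed P (consB v c b) = P v.
Proof. by move=> cv okb; rewrite /headed val_consB. Qed.

Lemma headedP P b : headed P b <->
  exists v c b', [/\ P v, (c < rank v)%N, fits v c b' & b = consB v c b'].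
Proof.
split=> [|[v [c [b' [Pv cv okb ->]]]]]; last by rewrite headed_consB.
case: (consB_surj b) => [-> //|[v [c [b' [cv okb ->]]]]].
by rewrite headed_consB // => Pv; exists v, c, b'.
Qed.

Lemma headed_sub (P Q : V -> Prop) b :
  (forall v, P v -> Q v) -> headed P b -> headed Q b.
Proof. by rewrite /headed; case: (val b) => // a _; apply. Qed.

(** The words that span N_v. *)
Definition below v b := headed (fun u => u = v \/ gtv v u) b.

Lemma below_sub v u b : gtv v u -> below u b -> below v b.
Proof.
move=> vu; apply: headed_sub => x [->|ux]; right => //.
exact: gtv_trans ux.
Qed.

Lemma not_fits v c b :
  ~ fits v c b <-> headed (fun u => gtv v u /\ rank u = c) b.
Proof.
rewrite /fits /headed; case: (val b) => [|a s]; first by split=> // /(_ I).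
by split=> [/contrapT//|va []].
Qed.

End Words.

(** The same words, as a type with a declared choice structure. *)
Definition word n (G : layered_graph n) : choiceType :=
  Choice.clone (basis_index G) _.

Arguments nilB {n G}.
Arguments consB {n G}.

(** * Recurrent sequences indexed by words *)

Section Module.
Variables (K : fieldType) (n : nat) (G : layered_graph n).
Local Notation V := (vertex G).
Local Notation B := (basis_index G).
Local Notation M := (fmod K (word G)).
Local Notation End := (@endo K (word G) nilB).
Local Notation vec := (@vec K (word G)).
Implicit Types (v u w : V) (b : B) (T : End).

(** The zeroth coordinate: it is nonzero on a word (v, k) b exactly for
    k = |v|, the case c = 0 of [consB]. *)
Definition fst_crd : End := fun b =>
  if val b is a :: s then
    if a.2 == rank a.1 then vec (insubd nilB s) else 0
  else 0.

Lemma fst_crd_consB v c b : (c < rank v)%N -> fits v c b ->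
  fst_crd (consB v c b) = vec b *+ (0 == c)%N.
Proof.
move=> cv okb; rewrite /fst_crd val_consB //= valKd.
have -> : (rank v - c == rank v)%N = (0 == c)%N by lia.
by case: (0 == c)%N; rewrite ?mulr1n ?mulr0n.
Qed.

(** Entry j of the sequence that T attaches to an element.  Locked, for else
    comparing coordinates at different places would expand the powers of T. *)
Definition crd T (j : nat) : End := locked (fst_crd * T ^+ j).

Lemma crd0 T : crd T 0 = fst_crd. Proof. by rewrite /crd -lock expr0 mulr1. Qed.

Lemma crdS T j x : eapp (crd T j.+1) x = eapp (crd T j) (eapp T x).
Proof. by rewrite /crd -!lock exprSr mulrA eapp_mul. Qed.

Lemma crdSb T j b : crd T j.+1 b = eapp (crd T j) (T b).
Proof. by rewrite -[LHS]eapp_vec crdS eapp_vec. Qed.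

(** T behaves like the shift on words headed by vertices of rank at most i. *)
Definition coherent T i := forall v c b,
  (rank v <= i)%N -> (c < rank v)%N -> fits v c b ->
  supp_in (below v) (T (consB v c b)) /\
  forall j, (j <= rank v)%N ->
    crd T j (consB v c b) =
    vec b *+ (j == c) + vec (consB v c b) *+ (j == rank v).

Definition low i b := headed (fun u => rank u <= i)%N b.

Lemma below_low v b : below v b -> low (rank v) b.
Proof. by apply: headed_sub => u [->//|/gtv_rank/ltnW]. Qed.

(** From place |u| on, no head of rank greater than |u| occurs in the sequence
    of a word headed by u: place |u| holds the word itself, and T maps the word
    into N_u, which reduces a later place to an earlier one. *)
Lemma crd_high T i r : coherent T i -> (r <= i)%N ->
  forall j b, (r <= j)%N -> low r b ->
  supp_in (fun b' => b' = nilB \/ low r b') (crd T j b).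
Proof.
move=> cohT; elim: r => [_ j b _ /headedP[v [c [b' [v0 cv _ _]]]]|r IHr ri].
  by move: cv; rewrite ltnNge (leq_trans v0).
elim=> // j IHj b; rewrite leq_eqVlt => /orP[/eqP[jr]|rj].
  subst j => /headedP[v [c [b' [vr cv okb ->]]]].
  have := vr; rewrite leq_eqVlt => /orP[/eqP vr'|vr'].
    have [_ ->] := cohT v c b' (leq_trans vr ri) cv okb; last by rewrite vr'.
    have -> : (r.+1 == c)%N = false by lia.
    have -> : (r.+1 == rank v)%N by lia.
    rewrite mulr0n add0r.
    by apply: supp_in_vec; right; rewrite /low headed_consB.
  apply: supp_in_sub (IHr (ltnW ri) _ _ _ _) => //.
    by move=> b1 [->|b1r]; [left|right; apply: headed_sub b1r => u /leqW].
  by rewrite /low headed_consB.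
move=> bl; rewrite crdSb; have /headedP[v [c [b' [vr cv okb eb]]]] := bl.
have [TN _] := cohT v c b' (leq_trans vr ri) cv okb.
rewrite eb; apply: supp_in_eapp TN => b1 b1v; apply: IHj => //.
by apply: headed_sub (below_low b1v) => u /leq_trans; apply.
Qed.

(** The map gam stands for the coordinates of v in two situations: while T is
    being extended to words headed by v, when [crd T] is not yet meaningful
    on them, and once T is known. *)
Section Surjectivity.
Variables (T : End) (i : nat) (v : V) (gam : nat -> End).
Hypotheses (cohT : coherent T i) (vi : (rank v <= i.+1)%N).
Hypothesis gam_v : forall j c b,
  (j < rank v)%N -> (c < rank v)%N -> fits v c b ->
  gam j (consB v c b) = vec b *+ (j == c).
Hypothesis gam_lt : forall j b, headed (gtv v) b -> gam j b = crd T j b.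

(** When the j-th prescribed entry involves only words to which (v, |v| - j)
    can be prepended, prepending it to all of them solves the system. *)
Lemma gam_surj0 (m : nat -> M) :
  (forall j, (j < rank v)%N -> supp_in (fits v j) (m j)) ->
  exists2 y, supp_in (below v) y &
    forall j, (j < rank v)%N -> eapp (gam j) y = m j.
Proof.
move=> mok; exists (\sum_(j < rank v) lext (fun b => vec (consB v j b)) (m j)).
  apply: supp_in_sum => j _; apply: supp_in_lext (mok j (ltn_ord j)) => b okb.
  by apply: supp_in_vec; rewrite /below headed_consB //; left.
move=> j jv; rewrite linear_sum (bigD1 (Ordinal jv)) //= big1 ?addr0 => [|k kj].
  move: (m j) (mok j jv); apply: supp_in_ind => [|x y|a x|b okb].
  - by rewrite ?lext0 !eappr0.
  - by rewrite lextD eapprD => -> ->.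
  - by rewrite lextZ eapprZ => ->.
  - by rewrite lext_vec eapp_vec gam_v // eqxx.
move: (m k) (mok k (ltn_ord k)); apply: supp_in_ind => [|x y|a x|b okb].
- by rewrite ?lext0 !eappr0.
- by rewrite lextD eapprD => -> ->; rewrite addr0.
- by rewrite lextZ eapprZ => ->; rewrite scaler0.
- rewrite lext_vec eapp_vec gam_v // (_ : (j == k) = false) //.
  by apply: contraNF kj => /eqP jk; apply/eqP/val_inj.
Qed.

(** Elimination of the words that obstruct [gam_surj0], from the highest place
    down.  At place c they are headed by vertices of rank c below v; they
    belong to N_v and are their own c-th coordinate, so subtracting their
    sequences clears place c.  At later places no head of rank greater than c
    occurs in these sequences, so nothing obstructing is added there. *)
Lemma gam_surj (m : nat -> M) :
  exists2 y, supp_in (below v) y &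
    forall j, (j < rank v)%N -> eapp (gam j) y = m j.
Proof.
suff: forall c, (c <= rank v)%N -> forall m : nat -> M,
  (forall j, (c <= j < rank v)%N -> supp_in (fits v j) (m j)) ->
  exists2 y, supp_in (below v) y &
    forall j, (j < rank v)%N -> eapp (gam j) y = m j.
  by move/(_ _ (leqnn _)); apply=> j; rewrite leqNgt andNb.
elim=> [_ {}m mok|c IHc cv {}m mok]; first exact: gam_surj0.
(* The obstructing words of the entry at place c. *)
pose d := proj_on (fun b => `[< ~ fits v c b >]) (m c).
have dsupp : supp_in (fun b => ~ fits v c b) d.
  move=> b; rewrite cf_proj_on; case: ifP => [/asboolP//|_].
  by rewrite eqxx.
have dbelow : supp_in (below v) d.
  by apply: supp_in_sub dsupp => b /not_fits; apply: headed_sub => u []; right.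
have gamd : eapp (gam c) d = d.
  move: dsupp; move: (d); apply: supp_in_ind => [|x y|a x|b /not_fits nok].
  - by rewrite ?lext0 !eappr0.
  - by rewrite !eapprD => -> ->.
  - by rewrite !eapprZ => ->.
  rewrite eapp_vec gam_lt; last by apply: headed_sub nok => u [].
  have /headedP[u [c' [b' [[vu uc] cu okb ->]]]] := nok.
  have ui : (rank u <= i)%N by lia.
  have [_ ->] := cohT ui cu okb; last by rewrite uc.
  by rewrite uc eqxx gtn_eqF ?mulr0n ?add0r -?uc.
have gamd_high j : (c < j < rank v)%N -> supp_in (fits v j) (eapp (gam j) d).
  move=> /andP[cj jv]; apply: supp_in_eapp dsupp => b /not_fits nok.
  rewrite gam_lt; last by apply: headed_sub nok => u [].
  have lowb : low c b by apply: headed_sub nok => u [_ ->].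
  have ci : (c <= i)%N by lia.
  apply: supp_in_sub (crd_high cohT ci (ltnW cj) lowb) => b1 [-> //|b1c].
  apply: contrapT => /not_fits /headedP[u [c' [b' [[vu uj] cu okb eb]]]].
  by move: b1c; rewrite /low eb headed_consB //; lia.
have [j|y yv ym] := IHc (ltnW cv) (fun j => m j - eapp (gam j) d).
  case/andP; rewrite leq_eqVlt => /orP[/eqP<- _|cj jv].
    rewrite gamd => b; rewrite cfB cf_proj_on; case: ifP => [_|].
      by rewrite subrr eqxx.
    by move=> /asboolPn /contrapT.
  by apply: supp_inB; [apply: mok; rewrite cj|apply: gamd_high; rewrite cj].
exists (y + d); first exact: supp_inD.
by move=> j jv; rewrite eapprD ym // subrK.
Qed.

End Surjectivity.

(** T preserves the span of the words in question, so no other value matters. *)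
Lemma crd_agree T T' i : coherent T i -> (forall b, low i b -> T' b = T b) ->
  forall j x, supp_in (low i) x -> eapp (crd T' j) x = eapp (crd T j) x.
Proof.
move=> cohT TT'; elim=> [|j IHj] x xi; first by rewrite !crd0.
rewrite !crdS (_ : eapp T' x = eapp T x).
  apply: IHj; apply: supp_in_eapp xi => b /headedP[v [c [b' [vi cv okb ->]]]].
  have [bv _] := cohT v c b' vi cv okb; apply: supp_in_sub bv => b1 /below_low.
  by apply: headed_sub => u /leq_trans; apply.
by apply: eapp_eq_on xi => b; apply: TT'.
Qed.

(** On a word headed by v of rank i + 1, T takes an element of N_v whose first
    entries are the shift of those prescribed for the word.  N_v contains words
    headed by v, on which T is being defined; but their first |v| entries are
    prescribed, so surjectivity may be used before T is known. *)
Lemma coherent_step T i : coherent T i -> exists T', coherent T' i.+1.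
Proof.
move=> cohT.
pose gam v j : End := fun b => if val b is a :: s then
  if a.1 == v then vec (insubd nilB s) *+ (j == rank v - a.2)%N
  else crd T j b else 0.
have gam_v v j c b : (c < rank v)%N -> fits v c b ->
    gam v j (consB v c b) = vec b *+ (j == c).
  by move=> cv okb; rewrite /gam val_consB //= eqxx valKd subKn // ltnW.
have gam_lt v j b : headed (gtv v) b -> gam v j b = crd T j b.
  rewrite /gam /headed; case: (val b) => // a s va; case: eqP => // av.
  by have := gtv_rank va; rewrite av ltnn.
pose good b y := (low i b -> y = T b) /\ forall v c b',
  (c < rank v)%N -> fits v c b' -> rank v = i.+1 -> b = consB v c b' ->
  supp_in (below v) y /\ forall j, (j < rank v)%N ->
    eapp (gam v j) y = vec b' *+ (j.+1 == c) + vec b *+ (j.+1 == rank v).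
have /choice[T' goodT'] : forall b, exists y, good b y.
  move=> b; case: (consB_surj b) => [eb|[v [c [b' [cv okb eb]]]]].
    exists (T b); split=> // v c b' cv okb _ eb'.
    by move: (congr1 val eb'); rewrite eb val_consB.
  have [vi|vi] := eqVneq (rank v) i.+1; last first.
    exists (T b); split=> // u c1 b1 cu okb1 ui eb1.
    by move: eb vi; rewrite eb1 => /consB_inj[]// <-; rewrite ui eqxx.
  have vi' : (rank v <= i.+1)%N by rewrite vi.
  have [y yv ym] := gam_surj cohT vi' (fun j c b _ => @gam_v v j c b) (gam_lt v)
    (fun j => vec b' *+ (j.+1 == c) + vec b *+ (j.+1 == rank v)).
  exists y; split=> [|u c1 b1 cu okb1 ui eb1].
    by rewrite /low eb headed_consB // vi ltnn.
  by have /consB_inj[] // := etrans (esym eb) eb1; move=> <- <- <-.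
exists T'; have TT' b : low i b -> T' b = T b by case: (goodT' b).
have agree := crd_agree cohT TT'.
move=> v c b vi cv okb; have [vi'|vi'] := leqP (rank v) i.
  have lowb : low i (consB v c b) by rewrite /low headed_consB.
  have [bv crdb] := cohT v c b vi' cv okb; split; first by rewrite TT'.
  move=> j /crdb <-; rewrite -eapp_vec agree ?eapp_vec //.
  exact: supp_in_vec.
have {}vi : rank v = i.+1 by lia.
have [_ /(_ v c b cv okb vi erefl)[bv crdb]] := goodT' (consB v c b).
split=> //.
(* The entries prescribed in advance are those of the extended T. *)
have crd_gam j : (j < rank v)%N -> forall x, supp_in (below v) x ->
    eapp (crd T' j) x = eapp (gam v j) x.
  elim: j => [|j IHj] jv x xv; apply: eapp_eq_on xv => b1 /headedP[u].
    move=> [c1 [b1' [[->|vu] cu okb1 ->]]].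
      by rewrite crd0 fst_crd_consB // gam_v.
    by rewrite gam_lt ?crd0 // headed_consB.
  move=> [c1 [b1' [[uv|vu] cu okb1 ->]]].
    subst u; rewrite crdSb.
    have [_ /(_ v c1 b1' cu okb1 vi erefl)[b1v crdb1]] :=
      goodT' (consB v c1 b1').
    by rewrite IHj ?crdb1 1?ltnW // gam_v // (ltn_eqF jv) mulr0n addr0.
  rewrite gam_lt ?headed_consB // -eapp_vec agree ?eapp_vec //.
  by apply: supp_in_vec; rewrite /low headed_consB //; have := gtv_rank vu; lia.
case=> [_|j jv]; last by rewrite crdSb crd_gam // crdb.
rewrite crd0 fst_crd_consB // (ltn_eqF (leq_ltn_trans (leq0n c) cv)).
by rewrite mulr0n addr0.
Qed.

Lemma coherent_exists i : exists T, coherent T i.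
Proof.
elim: i => [|i [T]]; last exact: coherent_step.
by exists 0 => v c b v0 cv; move: (leq_trans cv v0).
Qed.

Section Coherent.
Variable T : End.
Hypothesis cohT : coherent T n.
Local Notation crd := (crd T).

Lemma rank_le v : (rank v <= n)%N. Proof. by rewrite -ltnS ltn_ord. Qed.

Lemma crd_consB v c b j : (c < rank v)%N -> fits v c b -> (j <= rank v)%N ->
  crd j (consB v c b) = vec b *+ (j == c) + vec (consB v c b) *+ (j == rank v).
Proof. by move=> cv okb jv; have [_ ->] := cohT (rank_le v) cv okb. Qed.

Lemma below_stable v x : supp_in (below v) x -> supp_in (below v) (eapp T x).
Proof.
apply: supp_in_eapp => b /headedP[u [c [b' [uv cu okb ->]]]].
have [bu _] := cohT (rank_le u) cu okb.
by case: uv => [<-//|vu]; apply: supp_in_sub bu => b1; apply: below_sub.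
Qed.

Lemma crd_surj v (m : nat -> M) :
  exists2 y, supp_in (below v) y &
    forall j, (j < rank v)%N -> eapp (crd j) y = m j.
Proof.
apply: (gam_surj cohT (leqW (rank_le v))) => // j c b jv cv okb.
by rewrite crd_consB ?(ltn_eqF jv) ?mulr0n ?addr0 // ltnW.
Qed.

(** Uniqueness, by the elimination of [gam_surj] run backwards: if the first
    |v| entries of y vanish, the heads of y other than v have rank less than c,
    for c = |v| and then for every smaller c, since the heads of rank c would
    survive at place c.  What remains is a combination of words
    (v, |v| - c) b, and its c-th entry is the same combination of the b. *)
Lemma crd_inj v y : supp_in (below v) y ->
  (forall j, (j < rank v)%N -> eapp (crd j) y = 0) -> y = 0.
Proof.
move=> yv y0.
have top b c b' : (c < rank v)%N -> fits v c b' ->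
    headed (fun u => rank u < rank v)%N b ->
    cf b (vec (consB v c b')) = 0.
  move=> cv okb; rewrite cf_vec; case: eqP => // <-.
  by rewrite headed_consB // ltnn.
have descent c : (c <= rank v)%N ->
    supp_in (headed (fun u => u = v \/ gtv v u /\ rank u < c)%N) y.
  move=> /subnK; move: (rank v - c)%N => k; elim: k c => [|k IHk] c /= kc.
    move: kc; rewrite add0n => ->; apply: supp_in_sub yv => b.
    apply: headed_sub => u [->|vu]; first by left.
    by right; split=> //; apply: gtv_rank.
  have {IHk} yc :
      supp_in (headed (fun u => u = v \/ gtv v u /\ rank u < c.+1)%N) y.
    by apply: IHk; rewrite -kc addSnnS.
  have cv : (c < rank v)%N by lia.
  have coef b : ~ fits v c b -> cf b (eapp (crd c) y) = cf b y.
    move=> nok; have nok' := nok; move/not_fits: nok' => hb.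
    apply: cf_eapp_on yc => b1 /headedP[u [c1 [b1' [uv cu okb1 ->]]]].
    case: uv => [uv|[vu]].
      subst u; rewrite crd_consB // ?(ltnW cv) // (ltn_eqF cv) mulr0n addr0.
      rewrite -(cf_vec K b) top //; last first.
        by apply: headed_sub hb => u [/gtv_rank].
      case: eqP => [cc|]; rewrite ?mulr0n ?cf0 // mulr1n cf_vec.
      by case: eqP => // eb; case: nok; rewrite -eb cc.
    rewrite ltnS leq_eqVlt => /orP[/eqP uc|uc].
      rewrite crd_consB //; last by rewrite uc.
      have -> : (c == c1) = false by lia.
      have -> : (c == rank u) by rewrite uc.
      by rewrite mulr0n add0r mulr1n cf_vec.
    have lowb1 : low (rank u) (consB u c1 b1') by rewrite /low headed_consB.
    have nlow : ~ (b = nilB \/ low (rank u) b).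
      case=> [eb|]; first by move: hb; rewrite eb.
      have /headedP[w [c2 [b2 [[vw wc] cw okw ->]]]] := hb.
      by rewrite /low headed_consB //; lia.
    rewrite (supp_in_cf0 (crd_high cohT (rank_le u) (ltnW uc) lowb1) nlow).
    by case: eqP => // eb; case: nlow; right; rewrite -eb.
  move=> b yb; have := yc b yb; apply: contraPP => nb hb.
  case: (pselect (fits v c b)) => [okb|nok]; last first.
    by move: yb; rewrite -coef // y0 // cf0 eqxx.
  apply: nb; move: hb okb; rewrite /headed /fits; case: (val b) => // a s.
  move=> [->|[va]]; [by left|rewrite ltnS leq_eqVlt => /orP[/eqP ac []//|]].
  by right.
have {}yv : supp_in (headed (fun u => u = v)) y.
  apply: supp_in_sub (descent 0 (leq0n _)) => b.
  by apply: headed_sub => u [|[]].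
have coef' c b' : (c < rank v)%N -> fits v c b' ->
    cf b' (eapp (crd c) y) = cf (consB v c b') y.
  move=> cv okb; apply: cf_eapp_on yv => b1.
  case/headedP=> [u [c1 [b1' [-> cu okb1 ->]]]].
  rewrite crd_consB // ?(ltnW cv) // (ltn_eqF cv) mulr0n addr0 cfMn !cf_vec.
  rewrite -mulrnA mulnb; congr (_ *+ nat_of_bool _).
  apply/andP/eqP => [[/eqP-> /eqP->]//|].
  by case/consB_inj => // _ -> ->; rewrite !eqxx.
apply: fmodP => b; rewrite cf0; apply/eqP/negP => /negP yb.
have /headedP[u [c [b' [uv cu okb eb]]]] := yv b yb; subst u.
by move: yb; rewrite eb -coef' // y0 // cf0 eqxx.
Qed.

Lemma crd_eq v x y : supp_in (below v) x -> supp_in (below v) y ->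
  (forall j, (j < rank v)%N -> eapp (crd j) x = eapp (crd j) y) -> x = y.
Proof.
move=> xv yv xy; apply/eqP; rewrite -subr_eq0; apply/eqP.
apply: (crd_inj (supp_inB xv yv)) => j jv.
by rewrite eapprB xy // subrr.
Qed.

End Coherent.

(** The operator P v k is, up to sign, the action of e(v, k).  It returns the
    entry |v| of the element of N_v that has its argument at place |v| - k and
    zero at the other places before |v|.  For an edge from v to w, the element y
    of N_w with datum b at place |w| - k also lies in N_v, where its data are b
    and, at place |w| = |v| - 1, the element P w k b; while T y lies in N_w
    with data b, one place earlier, and P w k b at place |w| - 1.  Computing
    the entry |w| + 1 of y in both ways gives the last clause. *)
Theorem vertex_operators : exists P : V -> nat -> End,
  [/\ forall v k, (k == 0) || (rank v < k)%N -> P v k = 0,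
      forall v k b, (0 < k <= rank v)%N -> fits v (rank v - k) b ->
        P v k b = vec (consB v (rank v - k) b)
    & forall v w k, gtv v w -> rank v = (rank w).+1 -> (0 < k)%N ->
        P v k.+1 + P v 1%N * P w k = P w k.+1 + P w 1%N * P w k].
Proof.
have [T cohT] := coherent_exists n.
pose spec v k b y := supp_in (below v) y /\
  forall j, (j < rank v)%N -> eapp (crd T j) y = vec b *+ (j + k == rank v)%N.
have /choice[S HS] : forall q : V * nat * B, exists y, spec q.1.1 q.1.2 q.2 y.
  move=> [[v k] b] /=.
  have [y] := crd_surj cohT v (fun j => vec b *+ (j + k == rank v)%N).
  by exists y.
pose sol v k : End := fun b => S (v, k, b).
have sol_below v k x : supp_in (below v) (eapp (sol v k) x).
  by apply: supp_in_eapp (supp_in_T x) => b _; have [] := HS (v, k, b).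
have sol_crd v k j x : (j < rank v)%N ->
    eapp (crd T j) (eapp (sol v k) x) = x *+ (j + k == rank v)%N.
  move=> jv; move: x (supp_in_T x); apply: supp_in_ind => [|x y|a x|b _].
  - by rewrite !eappr0 mul0rn.
  - by rewrite !eapprD => -> ->; rewrite mulrnDl.
  - by rewrite !eapprZ => ->; rewrite scalerMnr.
  - by rewrite eapp_vec; have [_ ->] := HS (v, k, b).
pose P v k := crd T (rank v) * sol v k.
have PE v k b : P v k b = eapp (crd T (rank v)) (eapp (sol v k) (vec b)).
  by rewrite eapp_vec.
exists P; split=> [v k kv|v k b kv okb|v w k vw vw1 k0]; last apply: endoP => b.
- apply: endoP => b; rewrite PE [X in eapp _ X](_ : _ = 0) ?eappr0 //.
  apply: (crd_inj cohT (sol_below v k _)) => j jv.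
  by rewrite sol_crd // (_ : (_ == _) = false) //; lia.
- have cv : (rank v - k < rank v)%N by lia.
  have consv : supp_in (below v) (vec (consB v (rank v - k) b)).
    by apply: supp_in_vec; rewrite /below headed_consB //; left.
  rewrite PE (crd_eq cohT (sol_below v k _) consv) => [|j jv].
    rewrite eapp_vec crd_consB // eqxx (_ : (_ == _) = false); last by lia.
    by rewrite mulr0n add0r.
  rewrite sol_crd // eapp_vec crd_consB ?(ltnW jv) // (ltn_eqF jv) mulr0n addr0.
  by congr (_ *+ nat_of_bool _); lia.
have wv : supp_in (below v) (eapp (sol w k) (vec b)).
  by apply: supp_in_sub (sol_below w k (vec b)) => b1; apply: below_sub.
have crd_Pw : eapp (crd T (rank w)) (eapp (sol w k) (vec b)) = P w k b.
  by rewrite PE.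
have Ev : eapp (sol w k) (vec b) =
    eapp (sol v k.+1) (vec b) + eapp (sol v 1%N) (P w k b).
  apply: (crd_eq cohT wv) => [|j jv]; first by apply: supp_inD.
  rewrite eapprD (sol_crd v k.+1) // (sol_crd v 1%N) //.
  move: jv; rewrite vw1 ltnS leq_eqVlt.
  case/orP=> [/eqP->|jw].
    rewrite crd_Pw (_ : (_ + k.+1 == _)%N = false); last by lia.
    by rewrite (_ : (_ == _)%N = true) ?mulr0n ?add0r //; lia.
  rewrite sol_crd // (_ : (j + 1 == _)%N = false); last by lia.
  by rewrite mulr0n addr0; congr (_ *+ nat_of_bool _); lia.
have Ew : eapp T (eapp (sol w k) (vec b)) =
    eapp (sol w k.+1) (vec b) + eapp (sol w 1%N) (P w k b).
  apply: (crd_eq cohT) => [||j jw].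
  - exact: below_stable (sol_below w k _).
  - exact: supp_inD.
  rewrite eapprD (sol_crd w k.+1) // (sol_crd w 1%N) // -crdS.
  move: jw; rewrite leq_eqVlt.
  case/orP=> [/eqP jw|jw].
    rewrite jw crd_Pw (_ : (j + k.+1 == _)%N = false); last by lia.
    by rewrite (_ : (_ == _)%N = true) ?mulr0n ?add0r //; lia.
  rewrite sol_crd // (_ : (j + 1 == _)%N = false); last by lia.
  by rewrite mulr0n addr0; congr (_ *+ nat_of_bool _); lia.
have := crdS T (rank w) (eapp (sol w k) (vec b)).
have PM u m x : eapp (crd T (rank u)) (eapp (sol u m) x) = eapp (P u m) x.
  by rewrite eapp_mul.
rewrite -vw1 [in LHS]Ev Ew !eapprD !PM !eapp_vec => PvPw.
by rewrite !endoDE !endoME.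
Qed.

End Module.

(** * The representation on the space of words *)

Section PathPolynomials.
Variables (n : nat) (G : layered_graph n).
Local Notation V := (vertex G).
Local Notation E := (edge G).
Variables (R : nzRingType) (x : E -> R).
Implicit Types (e : E) (p q : seq E).

Lemma path_poly_cons e p :
  path_poly x (e :: p) = (1 - (x e)%:P * 'X) * path_poly x p.
Proof. by rewrite /path_poly big_cons. Qed.

Lemma coef_linear_mul (a : R) (f : {poly R}) k :
  ((1 - a%:P * 'X) * f)`_k = f`_k - a * (if k is k'.+1 then f`_k' else 0).
Proof.
rewrite mulrBl mul1r coefB -mulrA coefCM coefXM.
by case: k.
Qed.

Lemma path_elem0 p : path_elem x p 0 = 1.
Proof.
rewrite /path_elem mul1r; elim: p => [|e p IHp].
  by rewrite /path_poly big_nil coef1.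
by rewrite path_poly_cons coef_linear_mul IHp mulr0 subr0.
Qed.

Lemma path_elem_nil k : path_elem x [::] k.+1 = 0.
Proof. by rewrite /path_elem /path_poly big_nil coef1 mulr0. Qed.

Lemma path_elem_cons e p k :
  path_elem x (e :: p) k.+1 = path_elem x p k.+1 + x e * path_elem x p k.
Proof.
rewrite /path_elem path_poly_cons coef_linear_mul mulrBr; congr (_ + _).
by rewrite exprS mulN1r mulNr opprK [RHS]mulrA commr_sign -mulrA.
Qed.

Lemma path_elem_oversize p k : (size p < k)%N -> path_elem x p k = 0.
Proof.
elim: p k => [|e p IHp] [//|k] /=; first by rewrite path_elem_nil.
by rewrite ltnS => pk; rewrite path_elem_cons !IHp ?mulr0 ?addr0 // ltnW.
Qed.

(** A polynomial with constant coefficient 1 is invertible as a power series,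
    also over a noncommutative ring. *)
Lemma mulr_coef0_inj (f g h : {poly R}) : h`_0 = 1 -> f * h = g * h -> f = g.
Proof.
move=> h0 fgh; apply/eqP; rewrite -subr_eq0; apply/eqP.
have {fgh} : (f - g) * h = 0 by rewrite mulrBl fgh subrr.
move: (f - g) => {f g} f fh; apply/polyP => k; rewrite coef0.
elim/ltn_ind: k => k IHk; have := congr1 (fun q : {poly R} => q`_k) fh.
rewrite coefM coef0 big_ord_recr /= subnn h0 mulr1 big1 ?add0r // => i _.
by rewrite IHk ?mul0r.
Qed.

End PathPolynomials.

Section Representation.
Variables (K : fieldType) (n : nat) (G : layered_graph n).
Local Notation V := (vertex G).
Local Notation E := (edge G).
Local Notation End := (@endo K (word G) nilB).

(** An edge acts as the difference of the degree-one operators of its ends,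
    which makes P_tail = (1 - X_e t) P_head equivalent to the relation of
    [vertex_operators].  So the polynomial of a path from v to w is the quotient
    of P_v by P_w and depends only on v and w, as the relators require. *)
Theorem graph_alg_rep : exists Phi : {lrmorphism graph_alg G K -> End},
  forall v w p k b, walk v w p -> rank w = 0%N -> (0 < k <= rank v)%N ->
    fits v (rank v - k) b ->
    Phi (path_elem (@egen _ _ K) p k) b
      = (-1) ^+ k.+1 *: vec K (consB v (rank v - k) b : word G).
Proof.
have [P [P0 Pcons Pedge]] := @vertex_operators K n G.
pose X e : End := P (tail e) 1%N - P (head e) 1%N.
pose Q v : {poly End} := 1 - \poly_(k < (rank v).+1) P v k.
have coefQ v k : (Q v)`_k = (k == 0)%:R - P v k.
  rewrite coefB coef1 coef_poly ltnS; case: leqP => // vk.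
  by rewrite P0 ?vk ?orbT.
have Q0 v : (Q v)`_0 = 1 by rewrite coefQ P0 ?subr0.
have Qedge e : (1 - (X e)%:P * 'X) * Q (head e) = Q (tail e).
  apply/polyP => k; rewrite coef_linear_mul; case: k => [|k].
    by rewrite mulr0 subr0 !Q0.
  rewrite !coefQ !sub0r; case: k => [|k].
    by rewrite (P0 _ 0%N isT) subr0 mulr1 /X opprB addKr.
  rewrite sub0r mulrN opprK mulrBl.
  have /(canRL (addrK _))-> := Pedge _ _ k.+1 (gtv_edge e) (rank_tail e) isT.
  by rewrite opprB opprD addrCA.
have Qwalk v w p : walk v w p -> path_poly X p * Q w = Q v.
  elim: p v => [|e p IHp] v /=.
    by move/eqP->; rewrite /path_poly big_nil mul1r.
  by case/andP=> /eqP<- /IHp pw; rewrite path_poly_cons -mulrA pw Qedge.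
have XE (phi : {lrmorphism free_alg K E -> End}) :
    (forall e, phi (free_gen K e) = X e) ->
    forall p k, phi (path_elem (@free_gen K E) p k) = path_elem X p k.
  move=> phiX p k; rewrite rmorph_path_elem; congr (path_elem _ _ _).
  exact: funext.
have [phi phiX] := @free_alg_lift K E End X.
have [|Phi PhiE] := @alg_quot_lift K _ End _ (@relator_proper n G K) phi.
  move=> _ [v [w [p [q [k [pP qP _ ->]]]]]]; apply: etrans (rmorphB _ _ _) _.
  apply/eqP; rewrite subr_eq0; apply/eqP.
  apply: etrans (XE _ phiX p k) _; apply: etrans _ (esym (XE _ phiX q k)).
  move: pP qP; rewrite !is_pathE => /andP[_ /Qwalk pw] /andP[_ /Qwalk qw].
  by rewrite /path_elem (mulr_coef0_inj (Q0 w) (etrans pw (esym qw))).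
exists Phi => v w p k b pw w0 kv okb.
rewrite rmorph_path_elem (_ : Phi \o _ = X); last first.
  by apply: funext => e /=; rewrite /egen PhiE phiX.
have := Qwalk _ _ _ pw.
rewrite (_ : Q w = 1) ?mulr1 => [pv|]; last first.
  apply/polyP => j; rewrite coefQ coef1 P0 ?subr0 // w0.
  by case: j.
have [k0 _] := andP kv.
rewrite /path_elem pv coefQ (gtn_eqF k0) sub0r mulrN -mulNr -mulN1r -exprS.
rewrite -signr_odd mulr_sign -[in RHS]signr_odd scaler_sign -Pcons //.
by case: odd.
Qed.

End Representation.

(** * The weight filtration *)

Section Filtration.
Variables (K : fieldType) (n : nat) (G : layered_graph n).
Local Notation V := (vertex G).
Local Notation E := (edge G).
Local Notation A := (graph_alg G K).
Local Notation egen := (@egen n G K).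
Implicit Types (v w u : V) (e : E) (p q : seq E) (a b c d : A).

Definition edge_weight p : nat := (\sum_(e <- p) rank (tail e))%N.

(** The span of the monomials of weight strictly less than j, so that
    [filt j.+1] is the step of index j and [filt j] is the one before it. *)
Inductive filt (j : nat) : A -> Prop :=
| filt_mon p : (edge_weight p < j)%N -> filt j (\prod_(e <- p) egen e)
| filt_0 : filt j 0
| filt_D a b : filt j a -> filt j b -> filt j (a + b)
| filt_Z (x : K) a : filt j a -> filt j (x *: a).

Lemma filt_le i j a : (i <= j)%N -> filt i a -> filt j a.
Proof.
move=> ij; elim=> [p pi||b c _ fb _ fc|x b _ fb].
- exact/filt_mon/(leq_trans pi).
- exact: filt_0.
- exact: filt_D.
- exact: filt_Z.
Qed.

Lemma filtM i j a b : filt i a -> filt j b -> filt (i + j).-1 (a * b).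
Proof.
move=> fa fb; elim: fa => [p pi||a1 a2 _ f1 _ f2|x a1 _ f1].
- elim: fb => [q qj||b1 b2 _ f1 _ f2|x b1 _ f1].
  + rewrite -big_cat; apply: filt_mon; rewrite /edge_weight big_cat /=.
    by move: pi qj; rewrite /edge_weight; lia.
  + by rewrite mulr0; apply: filt_0.
  + by rewrite mulrDr; apply: filt_D.
  + by rewrite -scalerAr; apply: filt_Z.
- by rewrite mul0r; apply: filt_0.
- by rewrite mulrDl; apply: filt_D.
- by rewrite -scalerAl; apply: filt_Z.
Qed.

Lemma filt_exhausts a : exists j, filt j a.
Proof.
have [x <-] := alg_proj_surj a.
pose pr (y : fmod K {fmonom E}) : A := alg_proj (relation_ideal G K) y.
have pr0 : pr 0 = 0 by apply: (raddf0 (alg_proj _)).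
have prD y z : pr (y + z) = pr y + pr z by apply: (raddfD (alg_proj _)).
have prZ (l : K) y : pr (l *: y) = l *: pr y.
  exact: (@alg_proj_scalable _ _ (relation_ideal G K)).
move: (x : fmod K {fmonom E}) (supp_in_T (x : fmod K {fmonom E})).
apply: (@supp_in_ind _ _ _ (fun y => exists j, filt j (pr y))).
- by exists 0%N; rewrite pr0; apply: filt_0.
- move=> y z [i fi] [j fj]; exists (maxn i j); rewrite prD; apply: filt_D.
    exact: filt_le (leq_maxl _ _) fi.
  exact: filt_le (leq_maxr _ _) fj.
- by move=> c y [j fj]; exists j; rewrite prZ; apply: filt_Z.
move=> w _; exists (edge_weight w).+1.
have -> : pr (vec K w) = \prod_(e <- (w : seq E)) egen e.
  rewrite -(rmorph_prod (alg_proj _)); congr (alg_proj _ _).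
  rewrite vec.unlock; case: w => w /=.
  elim: w => [|e w IHw]; first by rewrite big_nil -fmoneE.
  rewrite big_cons -IHw [RHS]malgM_def fgmulUU mulr1; congr (<< _ >>).
  by rewrite [RHS]fmmulE fmuE.
exact: filt_mon.
Qed.

(** For elements of weight at most j, this is equality of the components in
    degree j of the associated graded algebra. *)
Definition eqv j a b := filt j (a - b).

Lemma eqv_refl j a : eqv j a a.
Proof. by rewrite /eqv subrr; apply: filt_0. Qed.

Lemma eqv_sym j a b : eqv j a b -> eqv j b a.
Proof.
by move=> ab; rewrite /eqv -[b - a]opprB -[- _]scaleN1r; apply: filt_Z.
Qed.

Lemma eqv_trans j b a c : eqv j a b -> eqv j b c -> eqv j a c.
Proof. by move=> ab bc; rewrite /eqv -(subrKA b); apply: filt_D. Qed.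

Lemma eqv_filt j a b : eqv j a b -> filt j.+1 b -> filt j.+1 a.
Proof.
move=> ab fb; rewrite -(subrK b a); apply: filt_D => //.
exact: filt_le (leqnSn _) ab.
Qed.

Lemma eqvM i j a b c d : filt i.+1 a -> filt j.+1 d ->
  eqv i a b -> eqv j c d -> eqv (i + j) (a * c) (b * d).
Proof.
move=> fa fd ab cd; rewrite /eqv -(subrKA (a * d)) -mulrBr -mulrBl.
apply: filt_D; first by have := filtM fa cd.
by have := filtM ab fd; rewrite addnS.
Qed.

(** The weight of the first k edges of any path from a vertex of rank r. *)
Definition wt r k : nat := (\sum_(i < k) (r - i))%N.

Lemma wtS r k : wt r.+1 k.+1 = (r.+1 + wt r k)%N.
Proof. by rewrite /wt big_ord_recl subn0. Qed.

Lemma wtSr r k : wt r k.+1 = (wt r k + (r - k))%N.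
Proof. by rewrite /wt big_ord_recr. Qed.

Lemma wt1 r : wt r 1 = r.
Proof. by rewrite wtSr /wt big_ord0 subn0. Qed.

Lemma wtD r k l : wt r (k + l) = (wt r k + wt (r - k) l)%N.
Proof.
elim: l => [|l IHl]; first by rewrite addn0 /wt big_ord0 addn0.
by rewrite addnS !wtSr IHl -addnA subnDA.
Qed.

Lemma edge_weight_take v w p k : walk v w p -> (k <= size p)%N ->
  edge_weight (take k p) = wt (rank v) k.
Proof.
rewrite /edge_weight; elim: p v k => [|e p IHp] v [|k] /=;
  rewrite ?big_nil /wt ?big_ord0 //.
case/andP=> /eqP<- pw pk; rewrite big_cons (IHp _ _ pw pk) rank_tail.
by rewrite -wtS.
Qed.

Lemma filt_take v w p k : walk v w p -> (k <= size p)%N ->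
  filt (wt (rank v) k).+1 (\prod_(e <- take k p) egen e).
Proof. by move=> pw pk; apply: filt_mon; rewrite (edge_weight_take pw pk). Qed.

(** Every other monomial of e(p, k) replaces some of the first k edges with
    later ones, which have smaller weight. *)
Lemma path_elem_lead v w p k : walk v w p -> (k <= size p)%N ->
  eqv (wt (rank v) k) (path_elem egen p k) (\prod_(e <- take k p) egen e).
Proof.
elim: p v k => [|e p IHp] v [|k] //=.
- by rewrite path_elem0 big_nil => _ _; apply: eqv_refl.
- by rewrite path_elem0 big_nil => _ _; apply: eqv_refl.
case/andP=> /eqP<- pw pk; rewrite path_elem_cons big_cons rank_tail wtS.
rewrite /eqv -addrA -mulrBr; apply: filt_D; last first.
  have fe : filt (rank (head e)).+2 (egen e).
    have := @filt_mon (rank (head e)).+2 [:: e].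
    by rewrite big_seq1 /edge_weight big_seq1 rank_tail; apply.
  by have := filtM fe (IHp _ _ pw pk); rewrite addSn.
have [kp|kp] := ltnP k (size p); last first.
  by rewrite path_elem_oversize //; apply: filt_0.
apply: filt_le (eqv_filt (IHp _ _ pw kp) (filt_take pw kp)).
by rewrite wtSr; lia.
Qed.

Lemma path_elem_parallel v w p q k : walk v w p -> walk v w q ->
  (0 < k <= size p)%N -> path_elem egen p k = path_elem egen q k.
Proof.
move=> pw qw kp.
have pq : size p = size q by have := walk_rank pw; rewrite (walk_rank qw); lia.
have p0 : (0 < size p)%N by lia.
have pP : is_path v w p by rewrite is_pathE pw andbT -size_eq0 -lt0n.
have qP : is_path v w q by rewrite is_pathE qw andbT -size_eq0 -lt0n -pq.
have projE r : path_elem egen r k =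
    alg_proj (relation_ideal G K) (path_elem (@free_gen K E) r k).
  by rewrite rmorph_path_elem.
apply/eqP; rewrite !projE eq_alg_proj; apply/mem_span_ideal/Ideal_gen.
by exists v, w, p, q, k.
Qed.

End Filtration.

(** * Straightening, and the basis *)

Lemma unsorted_split (T : Type) (r : rel T) s : ~~ sorted r s ->
  exists s1 a b s2, s = s1 ++ [:: a, b & s2] /\ ~~ r a b.
Proof.
case: s => //= a s; elim: s a => [//|b s IHs] a /=.
rewrite negb_and => /orP[rab|/IHs[s1 [c [d [s2 [-> rcd]]]]]].
  by exists [::], a, b, s.
by exists (a :: s1), c, d, s2.
Qed.

Section Straightening.
Variables (K : fieldType) (n : nat) (G : layered_graph n).
Local Notation V := (vertex G).
Local Notation E := (edge G).
Local Notation A := (graph_alg G K).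
Local Notation egen := (@egen n G K).
Variables (star : V) (chosen : {v : V | v != star} -> E).
Hypothesis rank0 : forall v, rank v = 0%N <-> v = star.
Hypothesis tail_chosen : forall v, tail (chosen v) = val v.
Implicit Types (v w u : V) (e : E) (p q : seq E) (s : seq (V * nat)).

Lemma chosen_edgeE v : v != star ->
  exists e, [/\ chosen_edge chosen v = Some e, tail e = v
    & next_vertex chosen v = head e].
Proof.
move=> vs; exists (chosen (Sub v vs)); rewrite /next_vertex /chosen_edge.
by rewrite insubT /= tail_chosen.
Qed.

(** The argument m is fuel for the recursion along chosen edges; the rank of v
    is enough to reach star. *)
Fixpoint cpath_rec m v : seq E :=
  if m is m'.+1 then
    if chosen_edge chosen v is Some e then e :: cpath_rec m' (head e) else [::]
  else [::].

Definition cpath v := cpath_rec (rank v) v.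

Lemma cpath_cons v : v != star -> exists e,
  [/\ tail e = v, chosen_edge chosen v = Some e, next_vertex chosen v = head e
    & cpath v = e :: cpath (head e)].
Proof.
move=> /chosen_edgeE[e [ve te ne]]; exists e; split=> //.
by rewrite /cpath -{1}te rank_tail /= ve.
Qed.

Lemma neq_star v k : rank v = k.+1 -> v != star.
Proof. by move=> vk; apply/eqP => /rank0; rewrite vk. Qed.

Lemma cpath_walk v : walk v star (cpath v).
Proof.
move: {2}(rank v) (erefl (rank v)) => m; elim: m v => [|m IHm] v vm.
  by rewrite /cpath vm /=; apply/eqP/rank0.
have [e [te _ _ ->]] := cpath_cons (neq_star vm).
rewrite /= te eqxx; apply: IHm.
by move: vm; rewrite -te rank_tail => -[].
Qed.

Lemma walk_star_size v p : walk v star p -> size p = rank v.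
Proof. by move/walk_rank->; rewrite (_ : rank star = 0%N) //; apply/rank0. Qed.

Lemma size_cpath v : size (cpath v) = rank v.
Proof. exact/walk_star_size/cpath_walk. Qed.

Lemma ehat_cpath v k : (k <= rank v)%N ->
  ehat K chosen v k = \prod_(e <- take k (cpath v)) egen e.
Proof.
elim: k v => [|k IHk] v kv; first by rewrite take0 big_nil /ehat big_ord0.
have vs : v != star by apply/eqP => /rank0 v0; rewrite v0 in kv.
have [e [te ve ne ->]] := cpath_cons vs.
rewrite /ehat big_ord_recl /= ve big_cons /=; congr (_ * _).
rewrite -IHk; last by move: kv; rewrite -te rank_tail.
by apply: eq_bigr => i _; rewrite -ne -iterSr.
Qed.

Definition pair_weight (a : V * nat) : nat := wt (rank a.1) a.2.
Definition weight s : nat := (\sum_(a <- s) pair_weight a)%N.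
Definition valid s : bool := all (fun a => 1 <= a.2 <= rank a.1)%N s.

Lemma ehat_filt v k : (k <= rank v)%N ->
  filt (wt (rank v) k).+1 (ehat K chosen v k).
Proof.
move=> kv; rewrite ehat_cpath //; apply: filt_take (cpath_walk v) _.
by rewrite size_cpath.
Qed.

(** The first k edges of p and of the chosen path are leading terms of one
    element of the algebra, by the relations. *)
Lemma path_lead_ehat v p k : walk v star p -> (0 < k <= rank v)%N ->
  eqv (wt (rank v) k) (\prod_(e <- take k p) egen e) (ehat K chosen v k).
Proof.
move=> pw /andP[k0 kv]; rewrite ehat_cpath //.
have sp := walk_star_size pw.
apply: eqv_trans (path_elem_lead K (cpath_walk v) _);
  last by rewrite size_cpath.
rewrite -(path_elem_parallel K pw (cpath_walk v)) ?k0 ?sp //.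
by apply: eqv_sym; apply: path_elem_lead pw _; rewrite sp.
Qed.

(** Straightening only sees leading terms; it is carried out for any family that
    shares those of ehat, to be applied to ehat itself and to [epath]. *)
Section Family.
Variable z : V -> nat -> A.
Hypothesis z_lead : forall v k, (0 < k <= rank v)%N ->
  eqv (wt (rank v) k) (z v k) (ehat K chosen v k).

Definition zprod s : A := \prod_(a <- s) z a.1 a.2.

Lemma z_filt v k : (0 < k <= rank v)%N -> filt (wt (rank v) k).+1 (z v k).
Proof.
by move=> kv; apply: eqv_filt (z_lead kv) (ehat_filt _); case/andP: kv.
Qed.

Lemma zprod_filt s : valid s -> filt (weight s).+1 (zprod s).
Proof.
rewrite /zprod /weight; elim: s => [_|a s IHs /= /andP[va vs]].
  have := @filt_mon K n G 1 [::]; rewrite !big_nil; apply.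
  by rewrite /edge_weight big_nil.
by rewrite !big_cons; have := filtM (z_filt va) (IHs vs); rewrite addnS.
Qed.

Lemma edge_lead e : eqv (rank (tail e)) (egen e) (z (tail e) 1%N).
Proof.
have r1 : (0 < 1 <= rank (tail e))%N by rewrite rank_tail.
rewrite -[X in eqv X]wt1; apply: eqv_trans (eqv_sym (z_lead r1)).
have ew : walk (tail e) star (e :: cpath (head e)).
  by rewrite /= eqxx cpath_walk.
by have := path_lead_ehat ew r1; rewrite /= take0 big_seq1.
Qed.

Lemma monomial_lead p : eqv (edge_weight p)
  (\prod_(e <- p) egen e) (zprod [seq (tail e, 1%N) | e <- p]).
Proof.
rewrite /edge_weight /zprod big_map; elim: p => [|e p IHp].
  by rewrite !big_nil; apply: eqv_refl.
rewrite !big_cons; apply: eqvM (edge_lead e) IHp.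
- have := @filt_mon K n G (rank (tail e)).+1 [:: e].
  by rewrite big_seq1 /edge_weight big_seq1; apply.
- have := @zprod_filt [seq (tail e, 1%N) | e <- p].
  rewrite /zprod /weight !big_map; under eq_bigr do rewrite /pair_weight wt1.
  by apply; rewrite /valid all_map; apply/allP => f _ /=; rewrite rank_tail.
Qed.

(** On the path that goes from v to u and then follows the chosen path of u, the
    first k + l edges are k edges from v to u and the first l chosen edges of
    u. *)
Lemma merge_lead v k u l : (0 < k <= rank v)%N -> (0 < l <= rank u)%N ->
  entails (v, k) (u, l) ->
  [/\ (0 < k + l <= rank v)%N,
      wt (rank v) (k + l) = (wt (rank v) k + wt (rank u) l)%N
    & eqv (wt (rank v) k + wt (rank u) l) (z v k * z u l) (z v (k + l))].
Proof.
move=> kv lu [/= /gtv_walk[p _ pw] /= uk].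
have klv : (0 < k + l <= rank v)%N by move: kv lu; rewrite uk; lia.
have wtkl : wt (rank v) (k + l) = (wt (rank v) k + wt (rank u) l)%N.
  by rewrite wtD uk.
split=> //.
have pk : size p = k.
  apply/eqP; rewrite -(eqn_add2l (rank u)) -(walk_rank pw) uk subnK //.
  by case/andP: kv.
have qw := cat_walk pw (cpath_walk u).
have takekl : take (k + l) (p ++ cpath u) = p ++ take l (cpath u).
  by rewrite take_cat pk ltnNge leq_addr /= addKn.
rewrite -wtkl; apply: eqv_trans (eqv_sym (z_lead klv)).
apply: eqv_trans (path_lead_ehat qw klv).
rewrite takekl big_cat wtkl; apply: eqvM.
- exact: z_filt.
- by apply: filt_take (cpath_walk u) _; rewrite size_cpath; case/andP: lu.
- apply: eqv_trans (z_lead kv) _; apply: eqv_sym.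
  by have := path_lead_ehat qw kv; rewrite take_cat -pk ltnn subnn take0 cats0.
- by rewrite -ehat_cpath; [apply: z_lead | case/andP: lu].
Qed.

Definition in_span j (x : A) : Prop := exists2 g : fmod K (word G),
  supp_in (fun b => (weight (val (b : basis_index G)) < j)%N) g
  & x = lext (fun b => zprod (val (b : basis_index G))) g.

Lemma in_span_le i j x : (i <= j)%N -> in_span i x -> in_span j x.
Proof.
move=> ij [g gi ->]; exists g => //.
by apply: supp_in_sub gi => b bi; apply: leq_trans ij.
Qed.

Lemma in_spanD j x y : in_span j x -> in_span j y -> in_span j (x + y).
Proof.
move=> [g gj ->] [h hj ->]; exists (g + h); first exact: supp_inD.
by rewrite lextD.
Qed.

Lemma in_spanZ j (a : K) x : in_span j x -> in_span j (a *: x).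
Proof.
by move=> [g gj ->]; exists (a *: g); [apply: supp_inZ|rewrite lextZ].
Qed.

Lemma in_span0 j : in_span j 0.
Proof. by exists 0; [apply: supp_in0|rewrite lext0]. Qed.

(** Each step below preserves the product modulo smaller weight, where the
    induction on j applies: an edge is replaced with z at its tail, then
    adjacent letters that are in the relation |= are merged, which shortens the
    word. *)
Lemma filt_span j x : filt j x -> in_span j x.
Proof.
elim: j x => [|j IHj] x.
  elim=> [p //||y y' _ sy _ sy'|a y _ sy].
  - exact: in_span0.
  - exact: in_spanD.
  - exact: in_spanZ.
have span_eqv y y' : eqv j y y' -> in_span j.+1 y' -> in_span j.+1 y.
  move=> yy' sy'; rewrite -(subrK y' y); apply: in_spanD => //.
  exact: in_span_le (leqnSn _) (IHj _ yy').
have span_zprod m s : (size s <= m)%N -> valid s -> weight s = j ->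
    in_span j.+1 (zprod s).
  elim: m s => [|m IHm] s sm vs sj.
    case: s sm vs sj => // _ _ w0; exists (vec K (nilB : word G)).
      by apply: supp_in_vec; rewrite w0.
    by rewrite lext_vec.
  have [ss|/unsorted_split[s1 [[v k] [[u l] [s2 [es]]]]]] :=
      boolP (sorted (fun a b => `[< ~ entails a b >]) s).
    have Bs : is_basis_index s by rewrite /is_basis_index ss andbT.
    pose b : basis_index G := exist _ s Bs.
    exists (vec K (b : word G)); first by apply: supp_in_vec; rewrite /= sj.
    by rewrite lext_vec.
  move=> /asboolPn /contrapT kl.
  move: vs sj sm; rewrite es /valid all_cat /= => /andP[vs1 /and3P[kv lu vs2]].
  have [klv wtkl zkl] := merge_lead kv lu kl.
  rewrite /weight big_cat !big_cons /= => sj; rewrite size_cat /= => sm.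
  have cw : pair_weight (v, (k + l)%N) =
    (pair_weight (v, k) + pair_weight (u, l))%N := wtkl.
  have vs : valid (s1 ++ (v, (k + l)%N) :: s2).
    by rewrite /valid all_cat vs1 /= klv vs2.
  have ws : weight (s1 ++ (v, (k + l)%N) :: s2) = j.
    by rewrite /weight big_cat big_cons cw -sj /= -[in LHS]addnA.
  apply: span_eqv (IHm _ _ vs ws); last by rewrite size_cat /=; lia.
  rewrite /zprod !big_cat !big_cons /= [z v k * _]mulrA.
  have -> : j = (weight s1 + ((wt (rank v) k + wt (rank u) l) + weight s2))%N.
    by rewrite -sj /weight; congr (_ + _)%N; rewrite addnA.
  apply: eqvM; [exact: zprod_filt| |exact: eqv_refl|].
    have := filtM (z_filt klv) (zprod_filt vs2).
    by rewrite wtkl addnS.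
  apply: eqvM => //; [|exact: zprod_filt|exact: eqv_refl].
  by have := filtM (z_filt kv) (z_filt lu); rewrite addnS.
elim=> [p||y y' _ sy _ sy'|a y _ sy].
- rewrite ltnS leq_eqVlt => /orP[/eqP pj|pj]; last first.
    by apply: in_span_le (leqnSn _) (IHj _ _); apply: filt_mon.
  apply: span_eqv; first by rewrite -pj; apply: monomial_lead.
  apply: (span_zprod _ _ (leqnn _)).
    by rewrite /valid all_map; apply/allP => f _ /=; rewrite rank_tail.
  rewrite /weight big_map -pj; apply: eq_bigr => e _.
  by rewrite /pair_weight wt1.
- exact: in_span0.
- exact: in_spanD.
- exact: in_spanZ.
Qed.

End Family.

Lemma zprod_eqv (z z' : V -> nat -> A) :
  (forall v k, (0 < k <= rank v)%N ->
     eqv (wt (rank v) k) (z v k) (ehat K chosen v k)) ->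
  (forall v k, (0 < k <= rank v)%N ->
     eqv (wt (rank v) k) (z' v k) (ehat K chosen v k)) ->
  forall s, valid s -> eqv (weight s) (zprod z s) (zprod z' s).
Proof.
move=> zl zl'; rewrite /zprod /weight; elim=> [|a s IHs] /=.
  by rewrite !big_nil => _; apply: eqv_refl.
case/andP=> va vs; rewrite !big_cons; apply: eqvM.
- exact: (z_filt zl va).
- exact: (zprod_filt zl' vs).
- exact: eqv_trans (zl _ _ va) (eqv_sym (zl' _ _ va)).
- exact: IHs.
Qed.

Lemma ehat_lead v k :
  eqv (wt (rank v) k) (ehat K chosen v k) (ehat K chosen v k).
Proof. exact: eqv_refl. Qed.

Lemma ehat_spanning :
  spanning (fun b : basis_index G => ehat_seq K chosen (val b)).
Proof.
move=> x; have [j xj] := filt_exhausts x.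
have [g _ ->] := filt_span (fun v k _ => ehat_lead v k) xj.
by exists (supp g), (fun b => cf (b : word G) g); rewrite lext.unlock.
Qed.

Definition epath v k : A := path_elem egen (cpath v) k.

Lemma epath_lead v k : (0 < k <= rank v)%N ->
  eqv (wt (rank v) k) (epath v k) (ehat K chosen v k).
Proof.
case/andP=> _ kv; rewrite ehat_cpath //; apply: path_elem_lead (cpath_walk v) _.
by rewrite size_cpath.
Qed.

Local Notation End := (@endo K (word G) nilB).

(** Apply a linear relation to the empty word.  The product indexed by b yields
    a nonzero multiple of b plus words of smaller weight ([act_ehat]), so the
    coefficients vanish one after the other, starting with those of largest
    weight. *)
Lemma ehat_independent :
  linearly_independent (fun b : basis_index G => ehat_seq K chosen (val b)).
Proof.
have [Phi PhiE] := @graph_alg_rep K n G.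
pose act x : fmod K (word G) := eapp (Phi x) (vec K (nilB : word G)).
have actM x y : act (x * y) = eapp (Phi x) (act y).
  by rewrite /act rmorphM eapp_mul.
have act0 : act 0 = 0 by rewrite /act raddf0 eapp0.
have actD : {morph act : x y / x + y}.
  by move=> x y; rewrite /act raddfD eapp_add.
have actZ (l : K) x : act (l *: x) = l *: act x.
  by rewrite /act linearZ eapp_scale.
have act1 : act 1 = vec K (nilB : word G) by rewrite /act rmorph1 eapp1.
have act_epath (b : basis_index G) : exists2 l : K, l != 0 &
    act (zprod epath (val b)) = l *: vec K (b : word G).
  move: {2}(size _) (leqnn (size (val b))) => m.
  elim: m b => [|m IHm] b bm;
    have [->|[v [c [b' [cv okb eb]]]]] := consB_surj b.
  - exists 1; rewrite ?oner_neq0 // /zprod big_nil act1.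
    by rewrite scale1r.
  - by move: bm; rewrite eb val_consB.
  - exists 1; rewrite ?oner_neq0 // /zprod big_nil act1.
    by rewrite scale1r.
  have vb : val b = (v, (rank v - c)%N) :: val b' by rewrite eb val_consB.
  have [|l l0 actb'] := IHm b'; first by move: bm; rewrite vb.
  exists (l * (-1) ^+ (rank v - c).+1).
    by rewrite mulf_neq0 // signr_eq0.
  rewrite vb /zprod big_cons actM [act _]actb' eapprZ eapp_vec.
  rewrite -scalerA eb; congr (_ *: _).
  have rvc : (rank v - (rank v - c) = c)%N by rewrite subKn // ltnW.
  have := PhiE v star (cpath v) (rank v - c)%N b' (cpath_walk v).
  by rewrite rvc subn_gt0 cv leq_subr; apply=> //; apply/rank0.
have act_filt j x : filt j x ->
    supp_in (fun b => weight (val (b : basis_index G)) < j)%N (act x).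
  case/(filt_span epath_lead)=> g gj ->.
  suff -> :
      act (lext (fun b : word G => zprod epath (val (b : basis_index G))) g) =
      lext (fun b : word G => act (zprod epath (val (b : basis_index G)))) g.
    apply: supp_in_lext gj => b bj; have [l _ ->] := act_epath b.
    by apply: supp_inZ; apply: supp_in_vec.
  move: g (supp_in_T g) {gj}.
  apply: supp_in_ind => [|y y' IHy IHy'|l y IHy|b _].
  - by rewrite !lext0 act0.
  - by rewrite !lextD actD IHy IHy'.
  - by rewrite !lextZ actZ IHy.
  - by rewrite !lext_vec.
have act_ehat (b : basis_index G) : exists2 l : K, l != 0 &
    forall b' : basis_index G, (weight (val b) <= weight (val b'))%N ->
      cf (b' : word G) (act (ehat_seq K chosen (val b))) = l * (b == b')%:R.
  have [l l0 actb] := act_epath b; exists l => // b' bb'.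
  have vb : valid (val b) by have /andP[] := valP b.
  have := zprod_eqv (fun v k _ => ehat_lead v k) epath_lead vb.
  move/act_filt/supp_in_cf0 => /(_ b') low0.
  rewrite -[ehat_seq _ _ _](subrK (zprod epath (val b))) actD cfD low0.
    by rewrite add0r actb cfZ cf_vec.
  by apply/negP; rewrite -leqNgt.
move=> s c us sum0 b bs.
(* Any common bound on the weights allows induction from the top down. *)
pose N := (\sum_(b' <- s) weight (val b'))%N.
have wN b' : b' \in s -> (weight (val b') <= N)%N.
  by move=> b's; rewrite /N (big_rem b') //= leq_addr.
move: {2}(N - weight (val b))%N (erefl (N - weight (val b))%N) => m.
elim/ltn_ind: m b bs => m IHm b bs Nb.
have [l l0 lb] := act_ehat b.
have : cf (b : word G)
    (act (\sum_(i <- s) c i *: ehat_seq K chosen (val i))) = 0.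
  by rewrite sum0 act0 cf0.
rewrite (big_morph act actD act0) cf_sum (bigD1_seq b) //= big1_seq ?addr0.
  rewrite actZ cfZ lb // eqxx mulr1 => /eqP.
  by rewrite mulf_eq0 (negPf l0) orbF => /eqP.
move=> i /andP[ib si]; rewrite actZ cfZ.
have [ib'|bi] := leqP (weight (val i)) (weight (val b)).
  by have [l' _ ->] := act_ehat i; rewrite // (negPf ib) !mulr0.
rewrite (IHm (N - weight (val i))%N _ i) ?mul0r //.
by rewrite -Nb; apply: ltn_sub2l (leq_trans bi (wN _ si)) bi.
Qed.

End Straightening.

Theorem corollary4p5 (F : fieldType) (n : nat) (G : layered_graph n)
    (star : vertex G) (chosen : {v : vertex G | v != star} -> edge G) :
  (forall v : vertex G, rank v = 0%N <-> v = star) ->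
  minimal_vertex star ->
  (forall v : {v : vertex G | v != star}, tail (chosen v) = val v) ->
  is_basis (fun b : basis_index G => ehat_seq F chosen (val b)).
Proof.
move=> rank0 _ tail_chosen; split; first exact: ehat_independent.
exact: ehat_spanning.
Qed.
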